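(* For difunctors $\mathbb{C}^{\bullet}\times\mathbb{C}\to\mathbb{D}$ of double categories, dinatural–natural composition satisfies the following laws. 1. Identity natural transformations are units: for a dinatural transformation $\alpha$ from $F$ to $G$, $\ (\mathrm{U}\,F)\odot\alpha\;\cong\;\alpha\;\cong\;\alpha\odot(\mathrm{U}\,G)$. 2. Composition with a composite natural transformation is iterated composition: for consecutive $\alpha,\beta,\gamma,\delta,\varepsilon$ with $\gamma$ dinatural and the rest natural, $\ (\alpha\odot\beta)\odot\gamma\cong\alpha\odot(\beta\odot\gamma)$ and $\gamma\odot(\delta\odot\varepsilon)\cong(\gamma\odot\delta)\odot\varepsilon$. 3. Two-sided dinatural–natural composition is associative: for consecutive $\alpha,\beta,\gamma$ with $\beta$ dinatural and $\alpha,\gamma$ natural, $\ (\alpha\odot\beta)\odot\gamma\cong\alpha\odot(\beta\odot\gamma)$. 4. Composition with a diagonalized identity natural transformation is diagonalization: for a natural transformation $\alpha:F\overset{\bullet}{\to}G$, $\ (\ddot{\mathrm{U}}\,F)\odot\alpha\;\cong\;\ddot\alpha\;\cong\;\alpha\odot(\ddot{\mathrm{U}}\,G)$, where $\ddot{\mathrm{U}}\,F$ is the diagonalization of the identity natural transformation $\mathrm{U}\,F$ and $\ddot\alpha$ is the diagonalization of $\alpha$.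
   Context: **Double categories.** A (weak) double category $\mathbb{C}$ has objects, arrows $f : A \to B$, proarrows $m : A \overset{\bullet}{\to} B$, and squares. A square $\varphi$ has a left proarrow $m : A \overset{\bullet}{\to} C$, a right proarrow $n : B \overset{\bullet}{\to} D$, a top arrow $f : A \to B$ and a bottom arrow $g : C \to D$. All composites are written in left-to-right (diagrammatic) order. Arrow-dimension composition, written $\cdot$ with units $\mathrm{id}$, composes arrows, and composes squares horizontally ($\varphi\cdot\psi$ is defined when the right proarrow of $\varphi$ is the left proarrow of $\psi$); it is strictly associative and unital. Proarrow-dimension composition, written $\odot$ with units $\mathrm{U}$, composes proarrows, and composes squares vertically ($\varphi\odot\psi$ is defined when the bottom arrow of $\varphi$ is the top arrow of $\psi$); it is associative and unital only up to coherent isomorphism. A proarrow disk $m \to n$ is a square with left proarrow $m$, right proarrow $n$, and identity top and bottom arrows; it is invertible if it has a two-sided inverse for $\cdot$. Associators and unitors for $\odot$ are suppressed, as are bracketings; an equation that holds after inserting the appropriate coherators is written with $\cong$ instead of $=$. For (di)natural transformations, $\cong$ means that the components agree up to composition coherators (object-component proarrows are related by the canonical associators/unitors, and arrow- and proarrow-components agree after composing with these). Dimensional promotion: a lower-dimensional cell appearing where a higher-dimensional one is expected denotes the corresponding identity (e.g. in $F(A,m)$ with $A$ an object and $m$ a proarrow, $A$ stands for $\mathrm{U}_A$; in $F(g,\varphi)$ with $g$ an arrow and $\varphi$ a square, $g$ stands for $\mathrm{U}_g$; a proarrow in a composite of squares stands for its $\mathrm{id}$). Products of double categories are componentwise. A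 functor is strict: it preserves boundaries and all composition structure in both dimensions. **Natural transformations.** For functors $F,G:\mathbb{E}\to\mathbb{D}$, a (proarrow-dimension pseudo) natural transformation $\alpha : F \overset{\bullet}{\to} G$ consists of: for each object $A$ a proarrow $\alpha A : FA \overset{\bullet}{\to} GA$; for each arrow $f : A \to B$ a square $\alpha f$ with left $\alpha A$, right $\alpha B$, top $Ff$, bottom $Gf$; for each proarrow $m : A \overset{\bullet}{\to} B$ an invertible proarrow disk $\alpha m : Fm \odot \alpha B \to \alpha A \odot Gm$; such that (i) $\alpha(\mathrm{id}_A)=\mathrm{id}_{\alpha A}$ and $\alpha(f\cdot g)=\alpha f\cdot\alpha g$; (ii) $\alpha(\mathrm{U}_A)\cong \mathrm{id}_{\alpha A}$ and $\alpha(m\odot n)\cong (Fm\odot\alpha n)\cdot(\alpha m\odot Gn)$; (iii) for each square $\varphi$ with left $m$, right $n$, top $f$, bottom $g$: $(F\varphi\odot\alpha g)\cdot\alpha n=\alpha m\cdot(\alpha f\odot G\varphi)$. The identity natural transformation $\mathrm{U}\,F:F\overset{\bullet}{\to}F$ has components $\mathrm{U}_{FA}$, $\mathrm{U}_{Ff}$, and $(\mathrm{U}\,F)m\cong\mathrm{id}_{Fm}$. The composite $\alpha\odot\beta:F\overset{\bullet}{\to}H$ of natural $\alpha:F\overset{\bullet}{\to}G$ and $\beta:G\overset{\bullet}{\to}H$ has components $\alpha A\odot\beta A$, $\alpha f\odot\beta f$, and $(\alpha\odot\beta)m\cong(\alpha m\odot\beta B)\cdot(\alpha A\odot\beta m)$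 for $m:A\overset{\bullet}{\to}B$. **Difunctors and dinatural transformations.** $\mathbb{C}^{\bullet}$ denotes the proarrow-dimension reflection of $\mathbb{C}$: it has the same objects, arrows, proarrows and squares, but with boundaries in the proarrow dimension transposed (a proarrow $m:A\overset{\bullet}{\to}B$ of $\mathbb{C}$ is a proarrow $B\overset{\bullet}{\to}A$ of $\mathbb{C}^\bullet$, and squares have top and bottom exchanged) and $\odot$-composition order reversed. A difunctor is a functor with domain $\mathbb{C}^{\bullet}\times\mathbb{C}$. For difunctors $F,G:\mathbb{C}^{\bullet}\times\mathbb{C}\to\mathbb{D}$, a (proarrow-dimension pseudo) dinatural transformation $\alpha$ from $F$ to $G$ consists of: for each object $A$ of $\mathbb{C}$ a proarrow $\alpha A:F(A,A)\overset{\bullet}{\to}G(A,A)$; for each arrow $f:A\to B$ of $\mathbb{C}$ a square $\alpha f$ with left $\alpha A$, right $\alpha B$, top $F(f,f)$, bottom $G(f,f)$; for each proarrow $m:A\overset{\bullet}{\to}B$ of $\mathbb{C}$ an invertible proarrow disk $\alpha m:F(B,m)\odot\alpha B\odot G(m,B)\to F(m,A)\odot\alpha A\odot G(A,m)$; such that (i) $\alpha(\mathrm{id}_A)=\mathrm{id}_{\alpha A}$, $\alpha(f\cdot g)=\alpha f\cdot\alpha g$; (ii) $\alpha(\mathrm{U}_A)\cong\mathrm{id}_{\alpha A}$ and, for $m:A\overset{\bullet}{\to}B$, $n:B\overset{\bullet}{\to}C$, $\alpha(m\odot n)\cong(F(C,m)\odot\alpha n\odot G(m,C))\cdot(F(n,A)\odot\alpha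 m\odot G(A,n))$; (iii) for each square $\varphi$ with left $m$, right $n$, top $f$, bottom $g$: $(F(g,\varphi)\odot\alpha g\odot G(\varphi,g))\cdot\alpha n\cong\alpha m\cdot(F(\varphi,f)\odot\alpha f\odot G(f,\varphi))$. **Diagonalization.** For a natural transformation $\alpha:F\overset{\bullet}{\to}G$ of difunctors, its diagonalization $\ddot\alpha$ is the dinatural transformation from $F$ to $G$ with $\ddot\alpha A=\alpha(A,A)$, $\ddot\alpha f=\alpha(f,f)$, and, for $m:A\overset{\bullet}{\to}B$ in $\mathbb{C}$, $\ddot\alpha m\cong(\alpha(B,m)\odot G(m,B))\cdot(\alpha(m,A)^{-1}\odot G(A,m))$. **Dinatural–natural composition.** For $\alpha$ dinatural from $F$ to $G$ and $\beta:G\overset{\bullet}{\to}H$ natural, $\alpha\odot\beta$ is the dinatural transformation from $F$ to $H$ with components $\alpha A\odot\beta(A,A)$, $\alpha f\odot\beta(f,f)$, and, for $m:A\overset{\bullet}{\to}B$, $(\alpha\odot\beta)m\cong(F(B,m)\odot\alpha B\odot\beta(m,B)^{-1})\cdot(\alpha m\odot\beta(A,B))\cdot(F(m,A)\odot\alpha A\odot\beta(A,m))$. Symmetrically, for $\alpha:F\overset{\bullet}{\to}G$ natural and $\beta$ dinatural from $G$ to $H$, $\alpha\odot\beta$ is the dinatural transformation from $F$ to $H$ with components $\alpha(A,A)\odot\beta A$, $\alpha(f,f)\odot\beta f$, and $(\alpha\odot\beta)m\cong(\alpha(B,m)\odot\beta B\odot H(m,B))\cdot(\alpha(B,A)\odot\beta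 m)\cdot(\alpha(m,A)^{-1}\odot\beta A\odot H(A,m))$. *)

(* Defs.v *)
From Stdlib Require Import Eqdep.
From Stdlib Require Import ssreflect.

Set Implicit Arguments.
Unset Strict Implicit.
Unset Printing Implicit Defensive.

(* Conventions.  All composites are in diagrammatic order:
     f · g     arrows                      φ ⋆ ψ   squares, arrow dimension
     m ⊙ n     proarrows                   φ ⊚ ψ   squares, proarrow dimension
     c ;; d    invertible proarrow disks (along ⋆)
   [Sq m n f g] has left m, right n, top f, bottom g.  *)

Record DblOps := {
  Ob :> Type;
  Arr : Ob -> Ob -> Type;
  Pro : Ob -> Ob -> Type;
  Sq : forall A B C D : Ob, Pro A C -> Pro B D -> Arr A B -> Arr C D -> Type;

  ida : forall A, Arr A A;
  compa : forall A B C, Arr A B -> Arr B C -> Arr A C;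
  idsq : forall A C (m : Pro A C), Sq m m (ida A) (ida C);
  hcomp : forall A B E C D F (m : Pro A C) (n : Pro B D) (p : Pro E F)
    (f : Arr A B) (f' : Arr B E) (g : Arr C D) (g' : Arr D F),
    Sq m n f g -> Sq n p f' g' -> Sq m p (compa f f') (compa g g');

  upro : forall A, Pro A A;
  odot : forall A B C, Pro A B -> Pro B C -> Pro A C;
  usq : forall A B (f : Arr A B), Sq (upro A) (upro B) f f;
  vcomp : forall A B C D E F (m : Pro A C) (n : Pro B D) (p : Pro C E) (q : Pro D F)
    (f : Arr A B) (g : Arr C D) (h : Arr E F),
    Sq m n f g -> Sq p q g h -> Sq (odot m p) (odot n q) f h;

  assoc_fwd : forall A B C D (m : Pro A B) (n : Pro B C) (p : Pro C D),
    Sq (odot (odot m n) p) (odot m (odot n p)) (ida A) (ida D);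
  assoc_bwd : forall A B C D (m : Pro A B) (n : Pro B C) (p : Pro C D),
    Sq (odot m (odot n p)) (odot (odot m n) p) (ida A) (ida D);
  lun_fwd : forall A B (m : Pro A B), Sq (odot (upro A) m) m (ida A) (ida B);
  lun_bwd : forall A B (m : Pro A B), Sq m (odot (upro A) m) (ida A) (ida B);
  run_fwd : forall A B (m : Pro A B), Sq (odot m (upro B)) m (ida A) (ida B);
  run_bwd : forall A B (m : Pro A B), Sq m (odot m (upro B)) (ida A) (ida B)
}.

Arguments Arr {d} _ _.
Arguments Pro {d} _ _.
Arguments Sq {d A B C D} _ _ _ _.
Arguments ida {d} A.
Arguments compa {d A B C} _ _.
Arguments idsq {d A C} m.
Arguments hcomp {d A B E C D F m n p f f' g g'} _ _.
Arguments upro {d} A.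
Arguments odot {d A B C} _ _.
Arguments usq {d A B} f.
Arguments vcomp {d A B C D E F m n p q f g h} _ _.
Arguments assoc_fwd {d A B C D} m n p.
Arguments assoc_bwd {d A B C D} m n p.
Arguments lun_fwd {d A B} m.
Arguments lun_bwd {d A B} m.
Arguments run_fwd {d A B} m.
Arguments run_bwd {d A B} m.

Notation "f · g" := (compa f g) (at level 40, left associativity).
Notation "φ ⋆ ψ" := (hcomp φ ψ) (at level 40, left associativity).
Notation "m ⊙ n" := (odot m n) (at level 35, right associativity).
Notation "φ ⊚ ψ" := (vcomp φ ψ) (at level 35, right associativity).

(* Equality of squares with the same corners whose four sides are equal but
   need not be convertible (e.g. φ ⋆ id against φ).  *)
Inductive sqeq {D : DblOps} {X Y Z W : D} {m : Pro X Z} {n : Pro Y W}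
    {f : Arr X Y} {g : Arr Z W} (φ : Sq m n f g) :
    forall (m' : Pro X Z) (n' : Pro Y W) (f' : Arr X Y) (g' : Arr Z W),
      Sq m' n' f' g' -> Prop :=
  sqeq_refl : sqeq φ φ.

Notation "φ ≡ ψ" := (sqeq φ ψ) (at level 70, no associativity).

Record DblLaws (D : DblOps) : Prop := {
  compa_idl : forall (A B : D) (f : Arr A B), ida A · f = f;
  compa_idr : forall (A B : D) (f : Arr A B), f · ida B = f;
  compa_assoc : forall (A B C E : D) (f : Arr A B) (g : Arr B C) (h : Arr C E),
    (f · g) · h = f · (g · h);

  hcomp_idl : forall (A B C E : D) (m : Pro A C) (n : Pro B E) f g (φ : Sq m n f g),
    idsq m ⋆ φ ≡ φ;
  hcomp_idr : forall (A B C E : D) (m : Pro A C) (n : Pro B E) f g (φ : Sq m n f g),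
    φ ⋆ idsq n ≡ φ;
  hcomp_assoc : forall (A B C E A' B' C' E' : D)
    (m : Pro A A') (n : Pro B B') (p : Pro C C') (q : Pro E E')
    (f : Arr A B) (g : Arr B C) (h : Arr C E)
    (f' : Arr A' B') (g' : Arr B' C') (h' : Arr C' E')
    (φ : Sq m n f f') (ψ : Sq n p g g') (χ : Sq p q h h'),
    (φ ⋆ ψ) ⋆ χ ≡ φ ⋆ (ψ ⋆ χ);

  vcomp_idsq : forall (A B C : D) (m : Pro A B) (n : Pro B C),
    idsq m ⊚ idsq n = idsq (m ⊙ n);
  interchange : forall (A B C A' B' C' A'' B'' C'' : D)
    (m : Pro A A') (n : Pro B B') (p : Pro C C')
    (m' : Pro A' A'') (n' : Pro B' B'') (p' : Pro C' C'')
    (f : Arr A B) (g : Arr B C) (f' : Arr A' B') (g' : Arr B' C')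
    (f'' : Arr A'' B'') (g'' : Arr B'' C'')
    (φ : Sq m n f f') (ψ : Sq n p g g') (φ' : Sq m' n' f' f'') (ψ' : Sq n' p' g' g''),
    (φ ⋆ ψ) ⊚ (φ' ⋆ ψ') = (φ ⊚ φ') ⋆ (ψ ⊚ ψ');
  usq_id : forall A : D, usq (ida A) = idsq (upro A);
  usq_comp : forall (A B C : D) (f : Arr A B) (g : Arr B C), usq (f · g) = usq f ⋆ usq g;

  assoc_fwd_bwd : forall (A B C E : D) (m : Pro A B) (n : Pro B C) (p : Pro C E),
    assoc_fwd m n p ⋆ assoc_bwd m n p ≡ idsq ((m ⊙ n) ⊙ p);
  assoc_bwd_fwd : forall (A B C E : D) (m : Pro A B) (n : Pro B C) (p : Pro C E),
    assoc_bwd m n p ⋆ assoc_fwd m n p ≡ idsq (m ⊙ (n ⊙ p));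
  lun_fwd_bwd : forall (A B : D) (m : Pro A B), lun_fwd m ⋆ lun_bwd m ≡ idsq (upro A ⊙ m);
  lun_bwd_fwd : forall (A B : D) (m : Pro A B), lun_bwd m ⋆ lun_fwd m ≡ idsq m;
  run_fwd_bwd : forall (A B : D) (m : Pro A B), run_fwd m ⋆ run_bwd m ≡ idsq (m ⊙ upro B);
  run_bwd_fwd : forall (A B : D) (m : Pro A B), run_bwd m ⋆ run_fwd m ≡ idsq m;

  assoc_nat : forall (A B C E A' B' C' E' : D)
    (m : Pro A B) (n : Pro B C) (p : Pro C E)
    (m' : Pro A' B') (n' : Pro B' C') (p' : Pro C' E') f g h k
    (φ : Sq m m' f g) (ψ : Sq n n' g h) (χ : Sq p p' h k),
    ((φ ⊚ ψ) ⊚ χ) ⋆ assoc_fwd m' n' p' ≡ assoc_fwd m n p ⋆ (φ ⊚ (ψ ⊚ χ));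
  lun_nat : forall (A B A' B' : D) (m : Pro A B) (m' : Pro A' B') f g (φ : Sq m m' f g),
    (usq f ⊚ φ) ⋆ lun_fwd m' ≡ lun_fwd m ⋆ φ;
  run_nat : forall (A B A' B' : D) (m : Pro A B) (m' : Pro A' B') f g (φ : Sq m m' f g),
    (φ ⊚ usq g) ⋆ run_fwd m' ≡ run_fwd m ⋆ φ;

  pentagon : forall (A B C E F : D)
    (m : Pro A B) (n : Pro B C) (p : Pro C E) (q : Pro E F),
    assoc_fwd (m ⊙ n) p q ⋆ assoc_fwd m n (p ⊙ q) ≡
    ((assoc_fwd m n p ⊚ idsq q) ⋆ assoc_fwd m (n ⊙ p) q) ⋆ (idsq m ⊚ assoc_fwd n p q);
  triangle : forall (A B C : D) (m : Pro A B) (n : Pro B C),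
    assoc_fwd m (upro B) n ⋆ (idsq m ⊚ lun_fwd n) ≡ run_fwd m ⊚ idsq n
}.

Record DblCat := { dbl_ops :> DblOps; dbl_laws : DblLaws dbl_ops }.

Section SqEq.
Variable D : DblCat.
Implicit Types A B C E : D.

Lemma sqeq_sym A B C E (m : Pro A C) (n : Pro B E) f g (φ : Sq m n f g)
    (m' : Pro A C) (n' : Pro B E) f' g' (ψ : Sq m' n' f' g') :
  φ ≡ ψ -> ψ ≡ φ.
Proof. by case. Qed.

Lemma sqeq_trans A B C E (m : Pro A C) (n : Pro B E) f g (φ : Sq m n f g)
    (m' : Pro A C) (n' : Pro B E) f' g' (ψ : Sq m' n' f' g')
    (m'' : Pro A C) (n'' : Pro B E) f'' g'' (χ : Sq m'' n'' f'' g'') :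
  φ ≡ ψ -> ψ ≡ χ -> φ ≡ χ.
Proof. by move=> H; case: H χ. Qed.

Definition castsq A B C E (m : Pro A C) (n : Pro B E) f g (m' : Pro A C) (n' : Pro B E) f' g'
    (em : m = m') (en : n = n') (ef : f = f') (eg : g = g') (φ : Sq m n f g) :
    Sq m' n' f' g' :=
  match em, en, ef, eg with eq_refl, eq_refl, eq_refl, eq_refl => φ end.

Lemma castsqE A B C E (m : Pro A C) (n : Pro B E) f g (m' : Pro A C) (n' : Pro B E) f' g'
    (em : m = m') (en : n = n') (ef : f = f') (eg : g = g') (φ : Sq m n f g) :
  castsq em en ef eg φ ≡ φ.
Proof. by case: _ / em; case: _ / en; case: _ / ef; case: _ / eg. Qed.

Lemma sqeqP A B C E (m : Pro A C) (n : Pro B E) f g (φ : Sq m n f g)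
    (m' : Pro A C) (n' : Pro B E) f' g' (ψ : Sq m' n' f' g') :
  φ ≡ ψ -> exists em en ef eg, ψ = castsq em en ef eg φ.
Proof. by case; exists eq_refl, eq_refl, eq_refl, eq_refl. Qed.

Lemma castsq_id A B C E (m : Pro A C) (n : Pro B E) f g em en ef eg (φ : Sq m n f g) :
  castsq em en ef eg φ = φ.
Proof.
by rewrite (UIP_refl _ _ em) (UIP_refl _ _ en) (UIP_refl _ _ ef) (UIP_refl _ _ eg).
Qed.

Lemma sqeq_eq A B C E (m : Pro A C) (n : Pro B E) f g (φ ψ : Sq m n f g) :
  φ ≡ ψ -> φ = ψ.
Proof. by move=> /sqeqP [em] [en] [ef] [eg] ->; rewrite castsq_id. Qed.

Lemma hcomp_sqeq A B A' B' A'' B''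
    (m : Pro A B) (n : Pro A' B') (p : Pro A'' B'') f f' g g'
    (φ : Sq m n f g) (ψ : Sq n p f' g')
    (m1 : Pro A B) (n1 : Pro A' B') (p1 : Pro A'' B'') f1 f1' g1 g1'
    (φ1 : Sq m1 n1 f1 g1) (ψ1 : Sq n1 p1 f1' g1') :
  φ ≡ φ1 -> ψ ≡ ψ1 -> φ ⋆ ψ ≡ φ1 ⋆ ψ1.
Proof.
move=> H; case: H ψ1 => ψ1 /sqeqP [em] [en] [ef] [eg].
case: _ / en ψ1; case: _ / ef; case: _ / eg => ψ1 ->.
by rewrite castsq_id.
Qed.

Lemma vcomp_sqeq A B C A' B' C'
    (m : Pro A B) (n : Pro A' B') (p : Pro B C) (q : Pro B' C') f g h
    (φ : Sq m n f g) (ψ : Sq p q g h)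
    (m1 : Pro A B) (n1 : Pro A' B') (p1 : Pro B C) (q1 : Pro B' C') f1 g1 h1
    (φ1 : Sq m1 n1 f1 g1) (ψ1 : Sq p1 q1 g1 h1) :
  φ ≡ φ1 -> ψ ≡ ψ1 -> φ ⊚ ψ ≡ φ1 ⊚ ψ1.
Proof.
move=> H; case: H ψ1 => ψ1 /sqeqP [em] [en] [ef] [eg].
case: _ / en ψ1; case: _ / em; case: _ / eg => ψ1 ->.
by rewrite castsq_id.
Qed.

End SqEq.

(* Invertible proarrow disks m → n. *)

Definition Disk (D : DblOps) (A B : D) (m n : Pro A B) := Sq m n (ida A) (ida B).

Record InvDisk (D : DblOps) (A B : D) (m n : Pro A B) := {
  fwd : Disk m n;
  bwd : Disk n m;
  fwd_bwd : fwd ⋆ bwd ≡ idsq m;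
  bwd_fwd : bwd ⋆ fwd ≡ idsq n
}.

Section InvDisks.
Variable D : DblCat.
Implicit Types A B C : D.

Definition dinv A B (m n : Pro A B) (c : InvDisk m n) : InvDisk n m :=
  {| fwd := bwd c; bwd := fwd c; fwd_bwd := bwd_fwd c; bwd_fwd := fwd_bwd c |}.

(* φ ⋆ ψ has boundary arrows id · id, so it is transported back to id. *)
Definition dhcomp A B (m n p : Pro A B) (φ : Disk m n) (ψ : Disk n p) : Disk m p :=
  castsq eq_refl eq_refl (compa_idl (dbl_laws D) (ida A)) (compa_idl (dbl_laws D) (ida B))
    (φ ⋆ ψ).

Lemma dhcompE A B (m n p : Pro A B) (φ : Disk m n) (ψ : Disk n p) : dhcomp φ ψ ≡ φ ⋆ ψ.
Proof. exact: castsqE. Qed.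

Lemma dhcomp_inv A B (m n p : Pro A B) (φ : Disk m n) (ψ : Disk n p)
    (φ' : Disk n m) (ψ' : Disk p n) :
  φ ⋆ φ' ≡ idsq m -> ψ ⋆ ψ' ≡ idsq n -> dhcomp φ ψ ⋆ dhcomp ψ' φ' ≡ idsq m.
Proof.
move=> Hφ Hψ; have L := dbl_laws D.
apply: sqeq_trans (hcomp_sqeq (dhcompE _ _) (dhcompE _ _)) _.
apply: sqeq_trans (hcomp_assoc L _ _ _) _.
apply: sqeq_trans Hφ; apply: hcomp_sqeq; first by [].
apply: sqeq_trans (sqeq_sym (hcomp_assoc L _ _ _)) _.
apply: sqeq_trans (hcomp_idl L φ'); exact: hcomp_sqeq.
Qed.

Definition dcomp A B (m n p : Pro A B) (c : InvDisk m n) (d : InvDisk n p) : InvDisk m p :=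
  {| fwd := dhcomp (fwd c) (fwd d); bwd := dhcomp (bwd d) (bwd c);
     fwd_bwd := dhcomp_inv (fwd_bwd c) (fwd_bwd d);
     bwd_fwd := dhcomp_inv (bwd_fwd d) (bwd_fwd c) |}.

Lemma vcomp_inv A B C (m m' : Pro A B) (n n' : Pro B C) (φ : Disk m m') (φ' : Disk m' m)
    (ψ : Disk n n') (ψ' : Disk n' n) :
  φ ⋆ φ' ≡ idsq m -> ψ ⋆ ψ' ≡ idsq n -> (φ ⊚ ψ) ⋆ (φ' ⊚ ψ') ≡ idsq (m ⊙ n).
Proof.
move=> Hφ Hψ; rewrite -(interchange (dbl_laws D)) -(vcomp_idsq (dbl_laws D)).
exact: vcomp_sqeq.
Qed.

Definition dodot A B C (m m' : Pro A B) (n n' : Pro B C) (c : InvDisk m m') (d : InvDisk n n') :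
    InvDisk (m ⊙ n) (m' ⊙ n') :=
  {| fwd := fwd c ⊚ fwd d; bwd := bwd c ⊚ bwd d;
     fwd_bwd := vcomp_inv (fwd_bwd c) (fwd_bwd d);
     bwd_fwd := vcomp_inv (bwd_fwd c) (bwd_fwd d) |}.

Definition did A B (m : Pro A B) : InvDisk m m :=
  {| fwd := idsq m : Disk m m; bwd := idsq m : Disk m m;
     fwd_bwd := hcomp_idl (dbl_laws D) (idsq m);
     bwd_fwd := hcomp_idl (dbl_laws D) (idsq m) |}.

Definition deq A B (m n : Pro A B) (e : m = n) : InvDisk m n :=
  match e in _ = k return InvDisk m k with eq_refl => did m end.

Definition assoc A B C E (m : Pro A B) (n : Pro B C) (p : Pro C E) :
    InvDisk ((m ⊙ n) ⊙ p) (m ⊙ (n ⊙ p)) :=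
  {| fwd := assoc_fwd m n p : Disk _ _; bwd := assoc_bwd m n p : Disk _ _;
     fwd_bwd := assoc_fwd_bwd (dbl_laws D) m n p;
     bwd_fwd := assoc_bwd_fwd (dbl_laws D) m n p |}.

Definition lun A B (m : Pro A B) : InvDisk (upro A ⊙ m) m :=
  {| fwd := lun_fwd m : Disk _ _; bwd := lun_bwd m : Disk _ _;
     fwd_bwd := lun_fwd_bwd (dbl_laws D) m;
     bwd_fwd := lun_bwd_fwd (dbl_laws D) m |}.

Definition run A B (m : Pro A B) : InvDisk (m ⊙ upro B) m :=
  {| fwd := run_fwd m : Disk _ _; bwd := run_bwd m : Disk _ _;
     fwd_bwd := run_fwd_bwd (dbl_laws D) m;
     bwd_fwd := run_bwd_fwd (dbl_laws D) m |}.

End InvDisks.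

Notation "c ;; d" := (dcomp c d) (at level 50, left associativity).
Notation "m ◁ c" := (dodot (did m) c) (at level 35, right associativity).
Notation "c ▷ n" := (dodot c (did n)) (at level 34, left associativity).

(* The proarrow-dimension reflection.  [odot] is reversed, so the associator is
   inverted and the two unitors are exchanged.  *)

Definition op_ops (C : DblOps) : DblOps := {|
  Ob := C;
  Arr := fun A B => Arr A B;
  Pro := fun A B => Pro B A;
  Sq := fun A B A' B' m n f g => Sq m n g f;
  ida := fun A => ida A;
  compa := fun A B E f g => f · g;
  idsq := fun A B m => idsq m;
  hcomp := fun A B E A' B' E' m n p f f' g g' φ ψ => φ ⋆ ψ;
  upro := fun A => upro A;
  odot := fun A B E m n => n ⊙ m;
  usq := fun A B f => usq f;
  vcomp := fun A B A' B' A'' B'' m n p q f g h φ ψ => ψ ⊚ φ;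
  assoc_fwd := fun A B E F m n p => assoc_bwd p n m;
  assoc_bwd := fun A B E F m n p => assoc_fwd p n m;
  lun_fwd := fun A B m => run_fwd m;
  lun_bwd := fun A B m => run_bwd m;
  run_fwd := fun A B m => lun_fwd m;
  run_bwd := fun A B m => lun_bwd m
|}.

Definition prod_ops (C D : DblOps) : DblOps := {|
  Ob := (C * D)%type;
  Arr := fun X Y => (Arr (fst X) (fst Y) * Arr (snd X) (snd Y))%type;
  Pro := fun X Y => (Pro (fst X) (fst Y) * Pro (snd X) (snd Y))%type;
  Sq := fun X Y Z W m n f g =>
    (Sq (fst m) (fst n) (fst f) (fst g) * Sq (snd m) (snd n) (snd f) (snd g))%type;
  ida := fun X => (ida (fst X), ida (snd X));
  compa := fun X Y Z f g => (fst f · fst g, snd f · snd g);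
  idsq := fun X Y m => (idsq (fst m), idsq (snd m));
  hcomp := fun A B E A' B' E' m n p f f' g g' φ ψ => (fst φ ⋆ fst ψ, snd φ ⋆ snd ψ);
  upro := fun X => (upro (fst X), upro (snd X));
  odot := fun X Y Z m n => (fst m ⊙ fst n, snd m ⊙ snd n);
  usq := fun X Y f => (usq (fst f), usq (snd f));
  vcomp := fun A B A' B' A'' B'' m n p q f g h φ ψ => (fst φ ⊚ fst ψ, snd φ ⊚ snd ψ);
  assoc_fwd := fun A B E F m n p =>
    (assoc_fwd (fst m) (fst n) (fst p), assoc_fwd (snd m) (snd n) (snd p));
  assoc_bwd := fun A B E F m n p =>
    (assoc_bwd (fst m) (fst n) (fst p), assoc_bwd (snd m) (snd n) (snd p));
  lun_fwd := fun A B m => (lun_fwd (fst m), lun_fwd (snd m));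
  lun_bwd := fun A B m => (lun_bwd (fst m), lun_bwd (snd m));
  run_fwd := fun A B m => (run_fwd (fst m), run_fwd (snd m));
  run_bwd := fun A B m => (run_bwd (fst m), run_bwd (snd m))
|}.

Lemma sqeq_op (C : DblOps) (A B A' B' : C) (m m' : Pro A' A) (n n' : Pro B' B) f f' g g'
    (φ : Sq m n f g) (ψ : Sq m' n' f' g') :
  φ ≡ ψ -> @sqeq (op_ops C) A B A' B' m n g f φ m' n' g' f' ψ.
Proof. by case. Qed.

Lemma sqeq_prod (C D : DblOps) (X Y X' Y' : prod_ops C D)
    (m m' : Pro X X') (n n' : Pro Y Y') f f' g g' (φ : Sq m n f g) (ψ : Sq m' n' f' g') :
  fst φ ≡ fst ψ -> snd φ ≡ snd ψ -> φ ≡ ψ.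
Proof.
case: X X' Y Y' m m' n n' f f' g g' φ ψ
  => [? ?] [? ?] [? ?] [? ?] [? ?] [? ?] [? ?] [? ?] [? ?] [? ?] [? ?] [? ?] [? ?] [? ?] /=.
by case; case.
Qed.

Lemma bwd_sqeq (D : DblCat) (A B : D) (m n : Pro A B) (c d : InvDisk m n) :
  fwd c ≡ fwd d -> bwd c ≡ bwd d.
Proof.
move=> H; have L := dbl_laws D.
apply: sqeq_trans (sqeq_sym (hcomp_idr L (bwd c))) _.
apply: sqeq_trans (hcomp_sqeq (sqeq_refl _) (sqeq_sym (fwd_bwd d))) _.
apply: sqeq_trans (sqeq_sym (hcomp_assoc L _ _ _)) _.
apply: sqeq_trans (hcomp_idl L (bwd d)).
apply: hcomp_sqeq (sqeq_refl _).
apply: sqeq_trans (bwd_fwd c); exact: (hcomp_sqeq (sqeq_refl _) (sqeq_sym H)).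
Qed.

(* Naturality with respect to invertible disks passes to their inverses. *)
Lemma bwd_nat (D : DblCat) (A B A' B' : D) (m n : Pro A B) (m' n' : Pro A' B')
    (c : InvDisk m n) (d : InvDisk m' n') f g (φ : Sq m m' f g) (ψ : Sq n n' f g) :
  φ ⋆ fwd d ≡ fwd c ⋆ ψ -> ψ ⋆ bwd d ≡ bwd c ⋆ φ.
Proof.
move=> H; have L := dbl_laws D.
apply: sqeq_trans (hcomp_sqeq (sqeq_sym (hcomp_idl L ψ)) (sqeq_refl _)) _.
apply: sqeq_trans
  (hcomp_sqeq (hcomp_sqeq (sqeq_sym (bwd_fwd c)) (sqeq_refl _)) (sqeq_refl _)) _.
apply: sqeq_trans (hcomp_sqeq (hcomp_assoc L _ _ _) (sqeq_refl _)) _.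
apply: sqeq_trans (hcomp_assoc L _ _ _) _.
apply: hcomp_sqeq (sqeq_refl _) _.
apply: sqeq_trans (hcomp_sqeq (sqeq_sym H) (sqeq_refl _)) _.
apply: sqeq_trans (hcomp_assoc L _ _ _) _.
apply: sqeq_trans (hcomp_sqeq (sqeq_refl _) (fwd_bwd d)) _.
exact: (hcomp_idr L φ).
Qed.

Lemma pentagon_bwd (D : DblCat) (A B C E F : D)
    (m : Pro A B) (n : Pro B C) (p : Pro C E) (q : Pro E F) :
  assoc_bwd m n (p ⊙ q) ⋆ assoc_bwd (m ⊙ n) p q ≡
  ((idsq m ⊚ assoc_bwd n p q) ⋆ assoc_bwd m (n ⊙ p) q) ⋆ (assoc_bwd m n p ⊚ idsq q).
Proof.
have L := dbl_laws D.
pose c := assoc (m ⊙ n) p q ;; assoc m n (p ⊙ q).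
pose d := assoc m n p ▷ q ;; assoc m (n ⊙ p) q ;; (m ◁ assoc n p q).
have H : fwd c ≡ fwd d.
  apply: sqeq_trans (dhcompE _ _) _; apply: sqeq_trans (pentagon L m n p q) _.
  apply: sqeq_sym; apply: sqeq_trans (dhcompE _ _) _.
  exact: (hcomp_sqeq (dhcompE _ _) (sqeq_refl _)).
apply: sqeq_trans (sqeq_sym (dhcompE _ _)) _.
apply: sqeq_trans (bwd_sqeq H) _.
apply: sqeq_trans (dhcompE _ _) _.
apply: sqeq_trans (hcomp_sqeq (sqeq_refl _) (dhcompE _ _)) _.
exact: (sqeq_sym (hcomp_assoc L _ _ _)).
Qed.

Lemma triangle_bwd (D : DblCat) (A B C : D) (m : Pro A B) (n : Pro B C) :
  assoc_bwd m (upro B) n ⋆ (run_fwd m ⊚ idsq n) ≡ idsq m ⊚ lun_fwd n.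
Proof.
have L := dbl_laws D.
apply: sqeq_trans (hcomp_sqeq (sqeq_refl _) (sqeq_sym (triangle L m n))) _.
apply: sqeq_trans (sqeq_sym (hcomp_assoc L _ _ _)) _.
apply: sqeq_trans (hcomp_sqeq (assoc_bwd_fwd L _ _ _) (sqeq_refl _)) _.
exact: (hcomp_idl L _).
Qed.

Lemma op_laws (C : DblCat) : DblLaws (op_ops C).
Proof.
have L := dbl_laws C; split=> /=.
- exact: (compa_idl L).
- exact: (compa_idr L).
- exact: (compa_assoc L).
- by move=> *; apply: sqeq_op; exact: (hcomp_idl L).
- by move=> *; apply: sqeq_op; exact: (hcomp_idr L).
- by move=> *; apply: sqeq_op; exact: (hcomp_assoc L).
- by move=> *; exact: (vcomp_idsq L).
- by move=> *; exact: (interchange L).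
- exact: (usq_id L).
- exact: (usq_comp L).
- by move=> *; apply: sqeq_op; exact: (assoc_bwd_fwd L).
- by move=> *; apply: sqeq_op; exact: (assoc_fwd_bwd L).
- by move=> *; apply: sqeq_op; exact: (run_fwd_bwd L).
- by move=> *; apply: sqeq_op; exact: (run_bwd_fwd L).
- by move=> *; apply: sqeq_op; exact: (lun_fwd_bwd L).
- by move=> *; apply: sqeq_op; exact: (lun_bwd_fwd L).
- move=> A B E F A' B' E' F' m n p m' n' p' f g h k φ ψ χ; apply: sqeq_op.
  exact: (@bwd_nat C _ _ _ _ _ _ _ _ (assoc p n m) (assoc p' n' m') _ _ _ _
    (assoc_nat L χ ψ φ)).
- by move=> *; apply: sqeq_op; exact: (run_nat L).
- by move=> *; apply: sqeq_op; exact: (lun_nat L).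
- by move=> *; apply: sqeq_op; exact: pentagon_bwd.
- by move=> *; apply: sqeq_op; exact: triangle_bwd.
Qed.

Lemma prod_laws (C D : DblCat) : DblLaws (prod_ops C D).
Proof.
have L := dbl_laws C; have L' := dbl_laws D; split=> /=.
- by move=> [? ?] [? ?] [f g] /=; rewrite (compa_idl L) (compa_idl L').
- by move=> [? ?] [? ?] [f g] /=; rewrite (compa_idr L) (compa_idr L').
- by move=> *; rewrite (compa_assoc L) (compa_assoc L').
- by move=> *; apply: sqeq_prod; [exact: (hcomp_idl L) | exact: (hcomp_idl L')].
- by move=> *; apply: sqeq_prod; [exact: (hcomp_idr L) | exact: (hcomp_idr L')].
- by move=> *; apply: sqeq_prod; [exact: (hcomp_assoc L) | exact: (hcomp_assoc L')].
- by move=> *; rewrite (vcomp_idsq L) (vcomp_idsq L').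
- by move=> *; rewrite (interchange L) (interchange L').
- by move=> *; rewrite (usq_id L) (usq_id L').
- by move=> *; rewrite (usq_comp L) (usq_comp L').
- by move=> *; apply: sqeq_prod; [exact: (assoc_fwd_bwd L) | exact: (assoc_fwd_bwd L')].
- by move=> *; apply: sqeq_prod; [exact: (assoc_bwd_fwd L) | exact: (assoc_bwd_fwd L')].
- by move=> *; apply: sqeq_prod; [exact: (lun_fwd_bwd L) | exact: (lun_fwd_bwd L')].
- by move=> *; apply: sqeq_prod; [exact: (lun_bwd_fwd L) | exact: (lun_bwd_fwd L')].
- by move=> *; apply: sqeq_prod; [exact: (run_fwd_bwd L) | exact: (run_fwd_bwd L')].
- by move=> *; apply: sqeq_prod; [exact: (run_bwd_fwd L) | exact: (run_bwd_fwd L')].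
- by move=> *; apply: sqeq_prod; [exact: (assoc_nat L) | exact: (assoc_nat L')].
- by move=> *; apply: sqeq_prod; [exact: (lun_nat L) | exact: (lun_nat L')].
- by move=> *; apply: sqeq_prod; [exact: (run_nat L) | exact: (run_nat L')].
- by move=> *; apply: sqeq_prod; [exact: (pentagon L) | exact: (pentagon L')].
- by move=> *; apply: sqeq_prod; [exact: (triangle L) | exact: (triangle L')].
Qed.

Definition op_dbl (C : DblCat) : DblCat := {| dbl_ops := op_ops C; dbl_laws := op_laws C |}.
Definition prod_dbl (C D : DblCat) : DblCat :=
  {| dbl_ops := prod_ops C D; dbl_laws := prod_laws C D |}.

(* Functors are strict; their laws are equalities up to the equality of the
   sides that the preceding laws provide.  *)

Record DblFun (E D : DblCat) := {
  fob :> E -> D;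
  farr : forall A B : E, Arr A B -> Arr (fob A) (fob B);
  fpro : forall A B : E, Pro A B -> Pro (fob A) (fob B);
  fsq : forall (A B A' B' : E) (m : Pro A A') (n : Pro B B') (f : Arr A B) (g : Arr A' B'),
    Sq m n f g -> Sq (fpro m) (fpro n) (farr f) (farr g);
  farr_id : forall A : E, farr (ida A) = ida (fob A);
  farr_comp : forall (A B C : E) (f : Arr A B) (g : Arr B C), farr (f · g) = farr f · farr g;
  fsq_id : forall (A B : E) (m : Pro A B), fsq (idsq m) ≡ idsq (fpro m);
  fsq_hcomp : forall (A B C A' B' C' : E) (m : Pro A A') (n : Pro B B') (p : Pro C C')
    (f : Arr A B) (g : Arr B C) (f' : Arr A' B') (g' : Arr B' C')
    (φ : Sq m n f f') (ψ : Sq n p g g'),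
    fsq (φ ⋆ ψ) ≡ fsq φ ⋆ fsq ψ;
  fpro_upro : forall A : E, fpro (upro A) = upro (fob A);
  fpro_odot : forall (A B C : E) (m : Pro A B) (n : Pro B C), fpro (m ⊙ n) = fpro m ⊙ fpro n;
  fsq_usq : forall (A B : E) (f : Arr A B), fsq (usq f) ≡ usq (farr f);
  fsq_vcomp : forall (A B A' B' A'' B'' : E)
    (m : Pro A A') (n : Pro B B') (p : Pro A' A'') (q : Pro B' B'')
    (f : Arr A B) (g : Arr A' B') (h : Arr A'' B'') (φ : Sq m n f g) (ψ : Sq p q g h),
    fsq (φ ⊚ ψ) ≡ fsq φ ⊚ fsq ψ;
  fsq_assoc : forall (A B C F : E) (m : Pro A B) (n : Pro B C) (p : Pro C F),
    fsq (assoc_fwd m n p) ≡ assoc_fwd (fpro m) (fpro n) (fpro p);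
  fsq_lun : forall (A B : E) (m : Pro A B), fsq (lun_fwd m) ≡ lun_fwd (fpro m);
  fsq_run : forall (A B : E) (m : Pro A B), fsq (run_fwd m) ≡ run_fwd (fpro m)
}.

Arguments farr {E D} d {A B} _.
Arguments fpro {E D} d {A B} _.
Arguments fsq {E D} d {A B A' B' m n f g} _.

Section FunDisk.
Variables (E D : DblCat) (F : DblFun E D).

Lemma fsq_sqeq (A B A' B' : E) (m : Pro A A') (n : Pro B B') f g (φ : Sq m n f g)
    (m' : Pro A A') (n' : Pro B B') f' g' (ψ : Sq m' n' f' g') :
  φ ≡ ψ -> fsq F φ ≡ fsq F ψ.
Proof. by case. Qed.

Definition fdisk1 (A B : E) (m n : Pro A B) (φ : Disk m n) : Disk (fpro F m) (fpro F n) :=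
  castsq eq_refl eq_refl (farr_id F A) (farr_id F B) (fsq F φ).

Lemma fdisk1_inv (A B : E) (m n : Pro A B) (φ : Disk m n) (ψ : Disk n m) :
  φ ⋆ ψ ≡ idsq m -> fdisk1 φ ⋆ fdisk1 ψ ≡ idsq (fpro F m).
Proof.
move=> H; apply: sqeq_trans (hcomp_sqeq (castsqE _ _ _ _ _) (castsqE _ _ _ _ _)) _.
apply: sqeq_trans (sqeq_sym (fsq_hcomp F _ _)) _.
apply: sqeq_trans (fsq_id F m); exact: fsq_sqeq H.
Qed.

Definition fdisk (A B : E) (m n : Pro A B) (c : InvDisk m n) :
    InvDisk (fpro F m) (fpro F n) :=
  {| fwd := fdisk1 (fwd c); bwd := fdisk1 (bwd c);
     fwd_bwd := fdisk1_inv (fwd_bwd c); bwd_fwd := fdisk1_inv (bwd_fwd c) |}.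

Definition fcomp (A B C : E) (m : Pro A B) (n : Pro B C) :
    InvDisk (fpro F (m ⊙ n)) (fpro F m ⊙ fpro F n) :=
  deq (fpro_odot F m n).

End FunDisk.

(* Natural transformations. *)

Record NatData (E D : DblCat) (F G : DblFun E D) := {
  nob : forall A : E, Pro (F A) (G A);
  narr : forall (A B : E) (f : Arr A B), Sq (nob A) (nob B) (farr F f) (farr G f);
  npro : forall (A B : E) (m : Pro A B), InvDisk (fpro F m ⊙ nob B) (nob A ⊙ fpro G m)
}.

Arguments nob {E D F G} n A.
Arguments narr {E D F G} n {A B} f.
Arguments npro {E D F G} n {A B} m.

Record NatLaws (E D : DblCat) (F G : DblFun E D) (α : NatData F G) : Prop := {
  narr_id : forall A : E, narr α (ida A) ≡ idsq (nob α A);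
  narr_comp : forall (A B C : E) (f : Arr A B) (g : Arr B C),
    narr α (f · g) ≡ narr α f ⋆ narr α g;
  npro_upro : forall A : E,
    fwd (npro α (upro A)) ≡ fwd (lun (nob α A) ;; dinv (run (nob α A)));
  npro_odot : forall (A B C : E) (m : Pro A B) (n : Pro B C),
    fwd (npro α (m ⊙ n)) ≡
    fwd (assoc (fpro F m) (fpro F n) (nob α C)
         ;; (fpro F m ◁ npro α n)
         ;; dinv (assoc (fpro F m) (nob α B) (fpro G n))
         ;; (npro α m ▷ fpro G n)
         ;; assoc (nob α A) (fpro G m) (fpro G n));
  npro_nat : forall (A B A' B' : E) (m : Pro A A') (n : Pro B B')
    (f : Arr A B) (g : Arr A' B') (φ : Sq m n f g),
    (fsq F φ ⊚ narr α g) ⋆ fwd (npro α n) ≡ fwd (npro α m) ⋆ (narr α f ⊚ fsq G φ)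
}.

Record NatTrans (E D : DblCat) (F G : DblFun E D) := {
  nat_data :> NatData F G;
  nat_laws : NatLaws nat_data
}.

Definition nat_id_data (E D : DblCat) (F : DblFun E D) : NatData F F := {|
  nob := fun A => upro (F A);
  narr := fun A B f => usq (farr F f);
  npro := fun A B m => run (fpro F m) ;; dinv (lun (fpro F m))
|}.

Definition nat_comp_data (E D : DblCat) (F G H : DblFun E D)
    (α : NatData F G) (β : NatData G H) : NatData F H := {|
  nob := fun A => nob α A ⊙ nob β A;
  narr := fun A B f => narr α f ⊚ narr β f;
  npro := fun A B m =>
    dinv (assoc (fpro F m) (nob α B) (nob β B))
    ;; (npro α m ▷ nob β B)
    ;; assoc (nob α A) (fpro G m) (nob β B)
    ;; (nob α A ◁ npro β m)
    ;; dinv (assoc (nob α A) (nob β A) (fpro H m))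
|}.

(* Difunctors C^• × C → D. *)

Definition Difun (C D : DblCat) := DblFun (prod_dbl (op_dbl C) C) D.

Section Difun.
Variables (C D : DblCat) (F : Difun C D).

Definition diob (A B : C) : D := F (A, B).

(* [dipro m n] is F(m, n) for m : A' ⇸ A and n : B ⇸ B' in C. *)
Definition dipro (A A' B B' : C) (m : Pro A' A) (n : Pro B B') :
    Pro (diob A B) (diob A' B') :=
  @fpro _ _ F (A, B) (A', B') (m, n).

Definition diarr (A A' B B' : C) (f : Arr A A') (g : Arr B B') :
    Arr (diob A B) (diob A' B') :=
  @farr _ _ F (A, B) (A', B') (f, g).

Definition disq (A B A' B' X Y X' Y' : C)
    (m : Pro A' A) (n : Pro B' B) (f : Arr A B) (f' : Arr A' B')
    (p : Pro X X') (q : Pro Y Y') (g : Arr X Y) (g' : Arr X' Y')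
    (φ : Sq m n f' f) (ψ : Sq p q g g') :
    Sq (dipro m p) (dipro n q) (diarr f g) (diarr f' g') :=
  @fsq _ _ F (A, X) (B, Y) (A', X') (B', Y') (m, p) (n, q) (f, g) (f', g') (φ, ψ).

Lemma pair_inv (A A' B B' : C) (m m' : Pro A' A) (n n' : Pro B B')
    (φ : Disk m m') (φ' : Disk m' m) (ψ : Disk n n') (ψ' : Disk n' n) :
  φ ⋆ φ' ≡ idsq m -> ψ ⋆ ψ' ≡ idsq n ->
  @sqeq (prod_ops (op_ops C) C) (A, B) (A, B) (A', B') (A', B')
    (m, n) (m, n) (ida A · ida A, ida B · ida B) (ida A' · ida A', ida B' · ida B')
    (φ ⋆ φ', ψ ⋆ ψ') (m, n) (m, n) (ida A, ida B) (ida A', ida B') (idsq m, idsq n).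
Proof. by move=> Hφ Hψ; apply: sqeq_prod => //; exact: sqeq_op. Qed.

(* F applied to a pair of invertible disks of C. *)
Definition didisk (A A' B B' : C) (m m' : Pro A' A) (n n' : Pro B B')
    (c : InvDisk m m') (d : InvDisk n n') : InvDisk (dipro m n) (dipro m' n') :=
  @fdisk _ _ F (A, B) (A', B') (m, n) (m', n')
    (@Build_InvDisk (prod_dbl (op_dbl C) C) (A, B) (A', B') (m, n) (m', n')
      (fwd c, fwd d) (bwd c, bwd d)
      (pair_inv (fwd_bwd c) (fwd_bwd d)) (pair_inv (bwd_fwd c) (bwd_fwd d))).

Definition dicomp (A A' A'' B B' B'' : C)
    (m : Pro A' A) (m' : Pro A'' A') (n : Pro B B') (n' : Pro B' B'') :
    InvDisk (dipro (m' ⊙ m) (n ⊙ n')) (dipro m n ⊙ dipro m' n') :=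
  @fcomp _ _ F (A, B) (A', B') (A'', B'') (m, n) (m', n').

(* F(X, m ⊙ n) ≅ F(X, m) ⊙ F(X, n): strictness of F splits F(U ⊙ U, m ⊙ n), so a
   unitor in the first variable is needed.  Contravariantly,
   F(m ⊙ n, X) ≅ F(n, X) ⊙ F(m, X).  *)
Definition split_r (X A B B' : C) (m : Pro A B) (n : Pro B B') :
    InvDisk (dipro (upro X) (m ⊙ n)) (dipro (upro X) m ⊙ dipro (upro X) n) :=
  didisk (dinv (lun (upro X))) (did (m ⊙ n)) ;; dicomp (upro X) (upro X) m n.

Definition split_l (X A B B' : C) (m : Pro A B) (n : Pro B B') :
    InvDisk (dipro (m ⊙ n) (upro X)) (dipro n (upro X) ⊙ dipro m (upro X)) :=
  didisk (did (m ⊙ n)) (dinv (lun (upro X))) ;; dicomp n m (upro X) (upro X).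

(* F(A', n) ⊙ F(m, B') ≅ F(m, n) ≅ F(m, B) ⊙ F(A, n) for m : A ⇸ A', n : B ⇸ B'. *)
Definition exch (A A' B B' : C) (m : Pro A A') (n : Pro B B') :
    InvDisk (dipro (upro A') n ⊙ dipro m (upro B'))
            (dipro m (upro B) ⊙ dipro (upro A) n) :=
  dinv (dicomp (upro A') m n (upro B'))
  ;; didisk (run m) (run n)
  ;; dinv (didisk (lun m) (lun n))
  ;; dicomp m (upro A) (upro B) n.

End Difun.

(* Components of a natural transformation of difunctors, in two variables. *)
Section Binat.
Variables (C D : DblCat) (F G : Difun C D) (α : NatData F G).

Definition nob2 (A B : C) : Pro (diob F A B) (diob G A B) := nob α (A, B).

Definition narr2 (A A' B B' : C) (f : Arr A A') (g : Arr B B') :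
    Sq (nob2 A B) (nob2 A' B') (diarr F f g) (diarr G f g) :=
  @narr _ _ _ _ α (A, B) (A', B') (f, g).

Definition npro2 (A A' B B' : C) (m : Pro A' A) (n : Pro B B') :
    InvDisk (dipro F m n ⊙ nob2 A' B') (nob2 A B ⊙ dipro G m n) :=
  @npro _ _ _ _ α (A, B) (A', B') (m, n).

End Binat.

(* Dinatural transformations; ternary composites are bracketed to the right. *)

Record DinatData (C D : DblCat) (F G : Difun C D) := {
  dob : forall A : C, Pro (diob F A A) (diob G A A);
  darr : forall (A B : C) (f : Arr A B), Sq (dob A) (dob B) (diarr F f f) (diarr G f f);
  dpro : forall (A B : C) (m : Pro A B),
    InvDisk (dipro F (upro B) m ⊙ (dob B ⊙ dipro G m (upro B)))
            (dipro F m (upro A) ⊙ (dob A ⊙ dipro G (upro A) m))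
}.

Arguments dob {C D F G} d A.
Arguments darr {C D F G} d {A B} f.
Arguments dpro {C D F G} d {A B} m.

(* For m : A ⇸ B and n : B ⇸ C, the composite
     (F(C,m) ⊙ αn ⊙ G(m,C)) ⋆ (F(n,A) ⊙ αm ⊙ G(A,n))
   from F(C,m⊙n) ⊙ αC ⊙ G(m⊙n,C) to F(m⊙n,A) ⊙ αA ⊙ G(A,m⊙n).  *)
Section DinatPaste.
Variables (C D : DblCat) (F G : Difun C D) (α : DinatData F G).

(* x ⊙ ((y ⊙ (z ⊙ w)) ⊙ v) ≅ (x ⊙ y) ⊙ (z ⊙ (w ⊙ v)) *)
Definition regroup (A1 A2 A3 A4 A5 A6 : D) (x : Pro A1 A2) (y : Pro A2 A3)
    (z : Pro A3 A4) (w : Pro A4 A5) (v : Pro A5 A6) :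
    InvDisk (x ⊙ ((y ⊙ (z ⊙ w)) ⊙ v)) ((x ⊙ y) ⊙ (z ⊙ (w ⊙ v))) :=
  (x ◁ (assoc y (z ⊙ w) v ;; (y ◁ assoc z w v))) ;; dinv (assoc x y (z ⊙ (w ⊙ v))).

Definition dpaste (A B E : C) (m : Pro A B) (n : Pro B E) :
    InvDisk (dipro F (upro E) (m ⊙ n) ⊙ (dob α E ⊙ dipro G (m ⊙ n) (upro E)))
            (dipro F (m ⊙ n) (upro A) ⊙ (dob α A ⊙ dipro G (upro A) (m ⊙ n))) :=
  dodot (split_r F E m n) (dob α E ◁ split_l G E m n)
  ;; dinv (regroup _ _ _ _ _)
  ;; (dipro F (upro E) m ◁ (dpro α n ▷ dipro G m (upro E)))
  ;; regroup _ _ _ _ _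
  ;; dodot (exch F n m) (dob α B ◁ exch G m n)
  ;; dinv (regroup _ _ _ _ _)
  ;; (dipro F n (upro A) ◁ (dpro α m ▷ dipro G (upro A) n))
  ;; regroup _ _ _ _ _
  ;; dodot (dinv (split_l F A m n)) (dob α A ◁ dinv (split_r G A m n)).

End DinatPaste.

Record DinatLaws (C D : DblCat) (F G : Difun C D) (α : DinatData F G) : Prop := {
  darr_id : forall A : C, darr α (ida A) ≡ idsq (dob α A);
  darr_comp : forall (A B E : C) (f : Arr A B) (g : Arr B E),
    darr α (f · g) ≡ darr α f ⋆ darr α g;
  dpro_upro : forall A : C,
    (* both sides of α(U_A) are U ⊙ (αA ⊙ U), by strictness of F and G *)
    let c := lun (dob α A ⊙ upro (diob G A A)) ;; run (dob α A) in
    fwd (dpro α (upro A)) ≡ fwd (c ;; dinv c);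
  dpro_odot : forall (A B E : C) (m : Pro A B) (n : Pro B E),
    fwd (dpro α (m ⊙ n)) ≡ fwd (dpaste α m n);
  dpro_nat : forall (A B A' B' : C) (m : Pro A A') (n : Pro B B')
    (f : Arr A B) (g : Arr A' B') (φ : Sq m n f g),
    (disq F (usq g) φ ⊚ (darr α g ⊚ disq G φ (usq g))) ⋆ fwd (dpro α n) ≡
    fwd (dpro α m) ⋆ (disq F φ (usq f) ⊚ (darr α f ⊚ disq G (usq f) φ))
}.

Record DinatTrans (C D : DblCat) (F G : Difun C D) := {
  dinat_data :> DinatData F G;
  dinat_laws : DinatLaws dinat_data
}.

(* [dinat_cong α β c] is α ≅ β, for c the canonical disks (associators or unitors)
   relating the object components: the arrow and proarrow components agree after
   composing with c.  *)
Definition dinat_cong (C D : DblCat) (F G : Difun C D) (α β : DinatData F G)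
    (c : forall A : C, InvDisk (dob α A) (dob β A)) : Prop :=
  (forall (A B : C) (f : Arr A B), darr α f ⋆ fwd (c B) ≡ fwd (c A) ⋆ darr β f) /\
  (forall (A B : C) (m : Pro A B),
    fwd (dpro α m ;; (dipro F m (upro A) ◁ (c A ▷ dipro G (upro A) m))) ≡
    fwd ((dipro F (upro B) m ◁ (c B ▷ dipro G m (upro B))) ;; dpro β m)).

Arguments dinat_cong {C D F G} α β c.

(* These operations act on components, as do the congruence [dinat_cong] and the
   formulas defining the composites; the laws enter through [NatTrans] and
   [DinatTrans].  *)

Definition diag_data (C D : DblCat) (F G : Difun C D) (α : NatData F G) : DinatData F G := {|
  dob := fun A => nob2 α A A;
  darr := fun A B f => narr2 α f f;
  dpro := fun A B m =>
    dinv (assoc (dipro F (upro B) m) (nob2 α B B) (dipro G m (upro B)))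
    ;; (npro2 α (upro B) m ▷ dipro G m (upro B))
    ;; assoc (nob2 α B A) (dipro G (upro B) m) (dipro G m (upro B))
    ;; (nob2 α B A ◁ exch G m m)
    ;; dinv (assoc (nob2 α B A) (dipro G m (upro A)) (dipro G (upro A) m))
    ;; (dinv (npro2 α m (upro A)) ▷ dipro G (upro A) m)
    ;; assoc (dipro F m (upro A)) (nob2 α A A) (dipro G (upro A) m)
|}.

Definition dinat_nat_data (C D : DblCat) (F G H : Difun C D)
    (α : DinatData F G) (β : NatData G H) : DinatData F H := {|
  dob := fun A => dob α A ⊙ nob2 β A A;
  darr := fun A B f => darr α f ⊚ narr2 β f f;
  dpro := fun A B m =>
    (dipro F (upro B) m ◁ assoc (dob α B) (nob2 β B B) (dipro H m (upro B)))
    ;; (dipro F (upro B) m ◁ (dob α B ◁ dinv (npro2 β m (upro B))))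
    ;; (dipro F (upro B) m ◁ dinv (assoc (dob α B) (dipro G m (upro B)) (nob2 β A B)))
    ;; dinv (assoc (dipro F (upro B) m) (dob α B ⊙ dipro G m (upro B)) (nob2 β A B))
    ;; (dpro α m ▷ nob2 β A B)
    ;; assoc (dipro F m (upro A)) (dob α A ⊙ dipro G (upro A) m) (nob2 β A B)
    ;; (dipro F m (upro A) ◁ assoc (dob α A) (dipro G (upro A) m) (nob2 β A B))
    ;; (dipro F m (upro A) ◁ (dob α A ◁ npro2 β (upro A) m))
    ;; (dipro F m (upro A) ◁ dinv (assoc (dob α A) (nob2 β A A) (dipro H (upro A) m)))
|}.

Definition nat_dinat_data (C D : DblCat) (F G H : Difun C D)
    (α : NatData F G) (β : DinatData G H) : DinatData F H := {|
  dob := fun A => nob2 α A A ⊙ dob β A;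
  darr := fun A B f => narr2 α f f ⊚ darr β f;
  dpro := fun A B m =>
    (dipro F (upro B) m ◁ assoc (nob2 α B B) (dob β B) (dipro H m (upro B)))
    ;; dinv (assoc (dipro F (upro B) m) (nob2 α B B) (dob β B ⊙ dipro H m (upro B)))
    ;; (npro2 α (upro B) m ▷ (dob β B ⊙ dipro H m (upro B)))
    ;; assoc (nob2 α B A) (dipro G (upro B) m) (dob β B ⊙ dipro H m (upro B))
    ;; (nob2 α B A ◁ dpro β m)
    ;; dinv (assoc (nob2 α B A) (dipro G m (upro A)) (dob β A ⊙ dipro H (upro A) m))
    ;; (dinv (npro2 α m (upro A)) ▷ (dob β A ⊙ dipro H (upro A) m))
    ;; assoc (dipro F m (upro A)) (nob2 α A A) (dob β A ⊙ dipro H (upro A) m)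
    ;; (dipro F m (upro A) ◁ dinv (assoc (nob2 α A A) (dob β A) (dipro H (upro A) m)))
|}.

(* Main.v *)
(* Invertible disks between proarrows of D form a bicategory in which all equations
   of the theorem live.  Bicategories are strictified by a Cayley representation:
   a disk m → n acts on the hom-groupoids by m ⊙ p → n ⊙ p, and after identifying
   m ⊙ p with its right-bracketed form every associator and unitor acts as an
   identity.  Comparing these actions, the unit laws and the iterated compositions
   become trivial, and two-sided associativity becomes two instances of the
   interchange law.  For diagonalizations the two composites differ by sliding
   F(m, n) ≅ F(A', n) ⊙ F(m, B') through α, which is naturality of α together with
   its compatibility with ⊙. *)

Require Import Defs.
From Stdlib Require Import ProofIrrelevance ssreflect.

Set Implicit Arguments.
Unset Strict Implicit.
Unset Printing Implicit Defensive.

(** * The bicategory of invertible disks, with equations as Leibniz equalities *)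

Section DiskAlgebra.
Variable D : DblCat.
Implicit Types A B C E : D.
Let L := dbl_laws D.

(** An inverse is unique and its laws are propositions, so the forward square determines the disk up
    to proof irrelevance. This makes equations of disks available for rewriting. *)
Lemma invdisk_eq A B (m n : Pro A B) (c d : InvDisk m n) : fwd c ≡ fwd d -> c = d.
Proof.
move=> H; have := sqeq_eq (bwd_sqeq H); have := sqeq_eq H.
case: c d {H} => [c c' p q] [d d' p' q'] /= e e'; case: _ / e p' q'; case: _ / e' => p' q'.
by rewrite (proof_irrelevance _ p p') (proof_irrelevance _ q q').
Qed.

Lemma fwd_sqeq A B (m n : Pro A B) (c d : InvDisk m n) : c = d -> fwd c ≡ fwd d.
Proof. by move->. Qed.

Lemma fwd_dcomp A B (m n p : Pro A B) (c : InvDisk m n) (d : InvDisk n p) :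
  fwd (c ;; d) ≡ fwd c ⋆ fwd d.
Proof. exact: dhcompE. Qed.

Lemma dcomp_eq A B (m n n' p : Pro A B) (c : InvDisk m n) (d : InvDisk n p)
    (c' : InvDisk m n') (d' : InvDisk n' p) :
  fwd c ⋆ fwd d ≡ fwd c' ⋆ fwd d' -> c ;; d = c' ;; d'.
Proof.
move=> H; apply: invdisk_eq; apply: sqeq_trans (fwd_dcomp _ _) _.
exact: (sqeq_trans H (sqeq_sym (fwd_dcomp _ _))).
Qed.

Lemma dcompA A B (m n p q : Pro A B) (c : InvDisk m n) (d : InvDisk n p) (e : InvDisk p q) :
  (c ;; d) ;; e = c ;; (d ;; e).
Proof.
apply: dcomp_eq; apply: sqeq_trans (hcomp_sqeq (dhcompE _ _) (sqeq_refl _)) _.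
apply: sqeq_trans (hcomp_assoc L _ _ _) _.
exact: (hcomp_sqeq (sqeq_refl _) (sqeq_sym (dhcompE _ _))).
Qed.

Lemma dcomp1 A B (m n : Pro A B) (c : InvDisk m n) : c ;; did n = c.
Proof.
apply: invdisk_eq; apply: sqeq_trans (fwd_dcomp _ _) _; exact: (hcomp_idr L (fwd c)).
Qed.

Lemma d1comp A B (m n : Pro A B) (c : InvDisk m n) : did m ;; c = c.
Proof.
apply: invdisk_eq; apply: sqeq_trans (fwd_dcomp _ _) _; exact: (hcomp_idl L (fwd c)).
Qed.

Lemma dcompV A B (m n : Pro A B) (c : InvDisk m n) : c ;; dinv c = did m.
Proof. apply: invdisk_eq; apply: sqeq_trans (fwd_dcomp _ _) _; exact: (fwd_bwd c). Qed.

Lemma dcompVl A B (m n : Pro A B) (c : InvDisk m n) : dinv c ;; c = did n.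
Proof. apply: invdisk_eq; apply: sqeq_trans (fwd_dcomp _ _) _; exact: (bwd_fwd c). Qed.

Lemma dcompK A B (m n p : Pro A B) (c : InvDisk m n) (d : InvDisk n p) :
  c ;; d ;; dinv d = c.
Proof. by rewrite dcompA dcompV dcomp1. Qed.

Lemma dKcomp A B (m n p : Pro A B) (c : InvDisk m n) (d : InvDisk m p) :
  c ;; (dinv c ;; d) = d.
Proof. by rewrite -dcompA dcompV d1comp. Qed.

Lemma dKVcomp A B (m n p : Pro A B) (c : InvDisk n m) (d : InvDisk m p) :
  dinv c ;; (c ;; d) = d.
Proof. by rewrite -dcompA dcompVl d1comp. Qed.

Lemma dcomp_injl A B (m n p : Pro A B) (c : InvDisk m n) (d d' : InvDisk n p) :
  c ;; d = c ;; d' -> d = d'.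
Proof. by move=> H; rewrite -(dKVcomp c d) H dKVcomp. Qed.

Lemma dcomp_injr A B (m n p : Pro A B) (c c' : InvDisk m n) (d : InvDisk n p) :
  c ;; d = c' ;; d -> c = c'.
Proof. by move=> H; rewrite -(dcompK c d) H dcompK. Qed.

(** Turns the exchange equation for a natural transformation into the comparison of two composites
    that each contain one inverse component. *)
Lemma dcomp_flip A B (m n p q r s : Pro A B) (a : InvDisk m n) (b : InvDisk n p)
    (c : InvDisk q r) (e : InvDisk m s) (f : InvDisk s q) (g : InvDisk p r) :
  e ;; (f ;; c) = a ;; (b ;; g) -> dinv a ;; (e ;; f) = b ;; (g ;; dinv c).
Proof.
move=> H; apply: (dcomp_injl (c := a)); apply: (dcomp_injr (d := c)).
by rewrite dKcomp !dcompA H dcompVl dcomp1.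
Qed.

Lemma dinv_comp A B (m n p : Pro A B) (c : InvDisk m n) (d : InvDisk n p) :
  dinv (c ;; d) = dinv d ;; dinv c.
Proof. exact: invdisk_eq. Qed.

Lemma dinv_id A B (m : Pro A B) : dinv (did m) = did m.
Proof. exact: invdisk_eq. Qed.

Lemma dinvK A B (m n : Pro A B) (c : InvDisk m n) : dinv (dinv c) = c.
Proof. exact: invdisk_eq. Qed.

Lemma dinv_odot A B C (m m' : Pro A B) (n n' : Pro B C) (c : InvDisk m m')
    (d : InvDisk n n') : dinv (dodot c d) = dodot (dinv c) (dinv d).
Proof. exact: invdisk_eq. Qed.

Lemma dodot_comp A B C (m m' m'' : Pro A B) (n n' n'' : Pro B C)
    (c : InvDisk m m') (c' : InvDisk m' m'') (d : InvDisk n n') (d' : InvDisk n' n'') :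
  dodot (c ;; c') (d ;; d') = dodot c d ;; dodot c' d'.
Proof.
apply: invdisk_eq; apply: sqeq_sym; apply: sqeq_trans (fwd_dcomp _ _) _.
rewrite /= -(interchange L).
exact: (vcomp_sqeq (sqeq_sym (dhcompE _ _)) (sqeq_sym (dhcompE _ _))).
Qed.

Lemma dodot_id A B C (m : Pro A B) (n : Pro B C) : dodot (did m) (did n) = did (m ⊙ n).
Proof. by apply: invdisk_eq; rewrite /= (vcomp_idsq L). Qed.

Lemma whisker_comp A B C (m : Pro A B) (n n' n'' : Pro B C)
    (d : InvDisk n n') (d' : InvDisk n' n'') : m ◁ (d ;; d') = (m ◁ d) ;; (m ◁ d').
Proof. by rewrite -dodot_comp d1comp. Qed.

Lemma comp_whisker A B C (m m' m'' : Pro A B) (n : Pro B C)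
    (c : InvDisk m m') (c' : InvDisk m' m'') : (c ;; c') ▷ n = (c ▷ n) ;; (c' ▷ n).
Proof. by rewrite -dodot_comp d1comp. Qed.

Lemma dodotE A B C (m m' : Pro A B) (n n' : Pro B C) (c : InvDisk m m')
    (d : InvDisk n n') : dodot c d = (c ▷ n) ;; (m' ◁ d).
Proof. by rewrite -dodot_comp d1comp dcomp1. Qed.

Lemma dodotE' A B C (m m' : Pro A B) (n n' : Pro B C) (c : InvDisk m m')
    (d : InvDisk n n') : dodot c d = (m ◁ d) ;; (c ▷ n').
Proof. by rewrite -dodot_comp d1comp dcomp1. Qed.

Lemma assoc_natural A B C E (m m' : Pro A B) (n n' : Pro B C) (p p' : Pro C E)
    (c : InvDisk m m') (d : InvDisk n n') (e : InvDisk p p') :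
  dodot (dodot c d) e ;; assoc m' n' p' = assoc m n p ;; dodot c (dodot d e).
Proof. apply: dcomp_eq; exact: (assoc_nat L). Qed.

Lemma lun_natural A B (m n : Pro A B) (c : InvDisk m n) :
  (upro A ◁ c) ;; lun n = lun m ;; c.
Proof. by apply: dcomp_eq; rewrite /= -(usq_id L); exact: (lun_nat L). Qed.

Lemma run_natural A B (m n : Pro A B) (c : InvDisk m n) :
  (c ▷ upro B) ;; run n = run m ;; c.
Proof. by apply: dcomp_eq; rewrite /= -(usq_id L); exact: (run_nat L). Qed.

Lemma dpentagon A B C E F (m : Pro A B) (n : Pro B C) (p : Pro C E) (q : Pro E F) :
  assoc (m ⊙ n) p q ;; assoc m n (p ⊙ q) =
  (assoc m n p ▷ q ;; assoc m (n ⊙ p) q) ;; (m ◁ assoc n p q).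
Proof.
apply: dcomp_eq => /=; apply: sqeq_trans (pentagon L m n p q) _.
exact: (hcomp_sqeq (sqeq_sym (dhcompE _ _)) (sqeq_refl _)).
Qed.

Lemma dtriangle A B C (m : Pro A B) (n : Pro B C) :
  assoc m (upro B) n ;; (m ◁ lun n) = run m ▷ n.
Proof. apply: invdisk_eq; apply: sqeq_trans (fwd_dcomp _ _) _; exact: (triangle L m n). Qed.

(** Naturality of [lun] makes whiskering with a unit a conjugation by an invertible disk, hence
    faithful. *)
Lemma upro_whisker_inj A B (m n : Pro A B) (c d : InvDisk m n) :
  upro A ◁ c = upro A ◁ d -> c = d.
Proof. by move=> H; apply: (@dcomp_injl _ _ _ _ _ (lun m)); rewrite -!lun_natural H. Qed.

Lemma whisker_upro_inj A B (m n : Pro A B) (c d : InvDisk m n) :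
  c ▷ upro B = d ▷ upro B -> c = d.
Proof. by move=> H; apply: (@dcomp_injl _ _ _ _ _ (run m)); rewrite -!run_natural H. Qed.

(* Kelly's derivation of the third unit law from the pentagon and the triangle. *)
Lemma lun_odot A B C (m : Pro A B) (n : Pro B C) :
  assoc (upro A) m n ;; lun (m ⊙ n) = lun m ▷ n.
Proof.
apply: upro_whisker_inj; rewrite whisker_comp.
apply: (@dcomp_injl _ _ _ _ _ (assoc (upro A) (upro A ⊙ m) n)).
rewrite -assoc_natural.
apply: (@dcomp_injl _ _ _ _ _ (assoc (upro A) (upro A) m ▷ n)).
rewrite -!dcompA -dpentagon -comp_whisker dtriangle dcompA dtriangle.
by rewrite assoc_natural dodot_id.
Qed.

End DiskAlgebra.

(** * Coherence through the Cayley representation *)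

Section Coherence.
Variable D : DblCat.

Inductive word : D -> D -> Type :=
| Wvar (A B : D) (m : Pro A B) : word A B
| Wone (A : D) : word A A
| Wodot (A B C : D) (t : word A B) (u : word B C) : word A C.

Fixpoint ev (A B : D) (t : word A B) : Pro A B :=
  match t with
  | Wvar m => m
  | Wone A => upro A
  | Wodot t u => ev t ⊙ ev u
  end.

(** Words that differ by bracketing or units act by convertible functions, so [actc] can send
    associators and unitors to [did] without any transport. *)
Fixpoint act (A B : D) (t : word A B) (X : D) : Pro B X -> Pro A X :=
  match t with
  | Wvar m => fun p => m ⊙ p
  | Wone A => fun p => p
  | Wodot t u => fun p => act t (act u p)
  end.

Fixpoint actd (A B : D) (t : word A B) (X : D) :
    forall p q : Pro B X, InvDisk p q -> InvDisk (act t p) (act t q) :=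
  match t with
  | Wvar m => fun p q c => m ◁ c
  | Wone A => fun p q c => c
  | Wodot t u => fun p q c => actd t (actd u c)
  end.

Fixpoint can (A B : D) (t : word A B) (X : D) :
    forall p : Pro B X, InvDisk (ev t ⊙ p) (act t p) :=
  match t with
  | Wvar m => fun p => did (m ⊙ p)
  | Wone A => fun p => lun p
  | Wodot t u => fun p => assoc (ev t) (ev u) p ;; (ev t ◁ can u p) ;; can t (act u p)
  end.

Lemma actd_comp (A B X : D) (t : word A B) (p q r : Pro B X) (c : InvDisk p q)
    (d : InvDisk q r) : actd t (c ;; d) = actd t c ;; actd t d.
Proof.
elim: t p q r c d => [A' B' m|A'|A' B' C t IHt u IHu] p q r c d //=.
  exact: whisker_comp.
by rewrite IHu IHt.
Qed.

Lemma actd_id (A B X : D) (t : word A B) (p : Pro B X) : actd t (did p) = did (act t p).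
Proof.
elim: t p => [A' B' m|A'|A' B' C t IHt u IHu] p //=; first exact: dodot_id.
by rewrite IHu IHt.
Qed.

Lemma actd_inv (A B X : D) (t : word A B) (p q : Pro B X) (c : InvDisk p q) :
  actd t (dinv c) = dinv (actd t c).
Proof.
elim: t p q c => [A' B' m|A'|A' B' C t IHt u IHu] p q c /=;
  rewrite ?IHu ?IHt // dinv_odot dinv_id.
Qed.

Lemma can_natural (A B X : D) (t : word A B) (p q : Pro B X) (c : InvDisk p q) :
  (ev t ◁ c) ;; can t q = can t p ;; actd t c.
Proof.
elim: t p q c => [A' B' m|A'|A' B' C t IHt u IHu] p q c /=.
- by rewrite dcomp1 d1comp.
- exact: lun_natural.
- rewrite -dodot_id -!dcompA assoc_natural (dcompA (assoc _ _ _)) -whisker_comp IHu.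
  by rewrite whisker_comp !dcompA IHt.
Qed.

(** A deep embedding is needed because the action follows how a disk is built, which an [InvDisk]
    does not reveal; [Cgen] admits any disk as an opaque generator. *)
Inductive cell : forall A B : D, word A B -> word A B -> Type :=
| Cgen (A B : D) (t u : word A B) (c : InvDisk (ev t) (ev u)) : cell t u
| Cid (A B : D) (t : word A B) : cell t t
| Ccomp (A B : D) (t u v : word A B) (c : cell t u) (d : cell u v) : cell t v
| Cinv (A B : D) (t u : word A B) (c : cell t u) : cell u t
| Codot (A B C : D) (t u : word A B) (t' u' : word B C) (c : cell t u) (d : cell t' u') :
    cell (Wodot t t') (Wodot u u')
| Cassoc (A B C E : D) (t : word A B) (u : word B C) (v : word C E) :
    cell (Wodot (Wodot t u) v) (Wodot t (Wodot u v))
| Clun (A B : D) (t : word A B) : cell (Wodot (Wone A) t) t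
| Crun (A B : D) (t : word A B) : cell (Wodot t (Wone B)) t.

Fixpoint evc (A B : D) (t u : word A B) (c : cell t u) : InvDisk (ev t) (ev u) :=
  match c with
  | Cgen c => c
  | Cid t => did (ev t)
  | Ccomp c d => evc c ;; evc d
  | Cinv c => dinv (evc c)
  | Codot c d => dodot (evc c) (evc d)
  | Cassoc t u v => assoc (ev t) (ev u) (ev v)
  | Clun t => lun (ev t)
  | Crun t => run (ev t)
  end.

Definition gact (A B : D) (t u : word A B) (c : InvDisk (ev t) (ev u)) (X : D)
    (p : Pro B X) : InvDisk (act t p) (act u p) :=
  dinv (can t p) ;; (c ▷ p) ;; can u p.

Fixpoint actc (A B : D) (t u : word A B) (c : cell t u) (X : D) :
    forall p : Pro B X, InvDisk (act t p) (act u p) :=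
  match c with
  | Cgen c => fun p => gact c p
  | Cid t => fun p => did (act t p)
  | Ccomp c d => fun p => actc c p ;; actc d p
  | Cinv c => fun p => dinv (actc c p)
  | @Codot _ _ _ t u t' u' c d => fun p => actc c (act t' p) ;; actd u (actc d p)
  | Cassoc t u v => fun p => did (act t (act u (act v p)))
  | Clun t => fun p => did (act t p)
  | Crun t => fun p => did (act t p)
  end.

(** This is the interchange law for [c] and a disk to its right, conjugated by [can]. *)
Lemma gact_natural (A B X : D) (t u : word A B) (c : InvDisk (ev t) (ev u))
    (p q : Pro B X) (d : InvDisk p q) :
  gact c p ;; actd u d = actd t d ;; gact c q.
Proof.
apply: (@dcomp_injl _ _ _ _ _ _ (can t p)).
rewrite /gact -!dcompA dcompV d1comp dcompA -!can_natural -dcompA -dodotE.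
by rewrite dcompK -dodotE'.
Qed.

(** The tail [k] matches the right-bracketed composites that [flat] produces, here and in
    [gactV_natural]. *)
Lemma gact_naturalV (A B X : D) (t u : word A B) (c : InvDisk (ev t) (ev u))
    (p q : Pro B X) (d : InvDisk q p) (s : Pro A X) (k : InvDisk (act u q) s) :
  gact c p ;; (dinv (actd u d) ;; k) = dinv (actd t d) ;; (gact c q ;; k).
Proof. by rewrite -(actd_inv u) -(actd_inv t) -dcompA gact_natural dcompA. Qed.

Lemma gactV_natural (A B X : D) (t u : word A B) (c : InvDisk (ev t) (ev u))
    (p q : Pro B X) (d : InvDisk p q) (s : Pro A X) (k : InvDisk (act t q) s) :
  dinv (gact c p) ;; (actd t d ;; k) = actd u d ;; (dinv (gact c q) ;; k).
Proof.
apply: (@dcomp_injl _ _ _ _ _ _ (gact c p)).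
by rewrite dKcomp -!dcompA gact_natural dcompK.
Qed.

(** Soundness of the representation: [can] intertwines whiskering with the action. The associator
    case is the pentagon, the left unitor case is [lun_odot], and the right unitor case is the
    triangle. *)
Lemma actc_natural (A B X : D) (t u : word A B) (c : cell t u) (p : Pro B X) :
  (evc c ▷ p) ;; can u p = can t p ;; actc c p.
Proof.
elim: c X p => {A B t u} /=.
- by move=> A B t u c X p; rewrite /gact -!dcompA dcompV d1comp.
- by move=> A B t X p; rewrite dodot_id d1comp dcomp1.
- by move=> A B t u v c IHc d IHd X p; rewrite comp_whisker dcompA IHd -!dcompA IHc.
- move=> A B t u c IHc X p.
  apply: (@dcomp_injl _ _ _ _ _ _ (evc c ▷ p)).
  rewrite -!dcompA -comp_whisker dcompV dodot_id d1comp IHc.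
  by rewrite dcompK.
- move=> A B C t u t' u' c IHc d IHd X p.
  rewrite -!dcompA assoc_natural (dcompA (assoc _ _ _)) -dodot_comp dcomp1 IHd.
  rewrite -(d1comp (evc c)) dodot_comp (dodotE (evc c)) -!dcompA.
  rewrite (dcompA _ _ (can u _)) can_natural.
  by rewrite -!dcompA (dcompA _ _ (can u _)) IHc -!dcompA.
- move=> A B C E t u v X p; rewrite dcomp1.
  rewrite !whisker_comp -!dcompA -dpentagon -[in RHS]dodot_id.
  by rewrite (dcompA (assoc _ _ _) (dodot (dodot _ _) _)) assoc_natural -!dcompA.
- move=> A B t X p; rewrite dcomp1 dcompA lun_natural -dcompA.
  by rewrite lun_odot.
- by move=> A B t X p; rewrite dcomp1 dtriangle.
Qed.

(* [flat c w p k] is [w] acting on [c], followed by [k], as a right-bracketed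
   composite of whiskered generators; [flatV] does the same for the inverse of [c].
   Accumulating [w] and [k] makes disks that differ only by coherence convertible. *)
Fixpoint flat (A B : D) (t u : word A B) (c : cell t u) :
    forall (X Y : D) (w : word Y A) (r : Pro Y X) (p : Pro B X),
      InvDisk (act w (act u p)) r -> InvDisk (act w (act t p)) r :=
  match c with
  | Cgen c => fun X Y w r p k => actd w (gact c p) ;; k
  | Cid t => fun X Y w r p k => k
  | Ccomp c d => fun X Y w r p k => flat c (flat d k)
  | Cinv c => fun X Y w r p k => flatV c k
  | @Codot _ _ _ t u t' u' c d => fun X Y w r p k =>
    flat c (w := w) (p := act t' p) (flat d (w := Wodot w u) (p := p) k)
  | Cassoc t u v => fun X Y w r p k => k
  | Clun t => fun X Y w r p k => k
  | Crun t => fun X Y w r p k => k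
  end
with flatV (A B : D) (t u : word A B) (c : cell t u) :
    forall (X Y : D) (w : word Y A) (r : Pro Y X) (p : Pro B X),
      InvDisk (act w (act t p)) r -> InvDisk (act w (act u p)) r :=
  match c with
  | Cgen c => fun X Y w r p k => dinv (actd w (gact c p)) ;; k
  | Cid t => fun X Y w r p k => k
  | Ccomp c d => fun X Y w r p k => flatV d (flatV c k)
  | Cinv c => fun X Y w r p k => flat c k
  | @Codot _ _ _ t u t' u' c d => fun X Y w r p k =>
    flatV d (w := Wodot w u) (p := p) (flatV c (w := w) (p := act t' p) k)
  | Cassoc t u v => fun X Y w r p k => k
  | Clun t => fun X Y w r p k => k
  | Crun t => fun X Y w r p k => k
  end.

(** Both halves are proved together, since [Cinv] swaps [flat] and [flatV]. *)
Lemma flatE (A B : D) (t u : word A B) (c : cell t u) :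
  (forall (X Y : D) (w : word Y A) (r : Pro Y X) (p : Pro B X) (k : InvDisk _ r),
    flat c k = actd w (actc c p) ;; k) /\
  (forall (X Y : D) (w : word Y A) (r : Pro Y X) (p : Pro B X) (k : InvDisk _ r),
    flatV c k = dinv (actd w (actc c p)) ;; k).
Proof.
elim: c => {A B t u} /=.
- by [].
- by split=> *; rewrite actd_id ?dinv_id d1comp.
- move=> A B t u v c [IH IHV] d [IH' IHV']; split=> X Y w r p k.
    by rewrite IH IH' actd_comp dcompA.
  by rewrite IHV IHV' actd_comp dinv_comp dcompA.
- move=> A B t u c [IH IHV]; split=> X Y w r p k.
    by rewrite IHV actd_inv.
  by rewrite IH actd_inv dinvK.
- move=> A B C t u t' u' c [IH IHV] d [IH' IHV']; split=> X Y w r p k.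
    by rewrite IH IH' actd_comp dcompA.
  by rewrite IHV IHV' actd_comp dinv_comp dcompA.
- by split=> *; rewrite actd_id ?dinv_id d1comp.
- by split=> *; rewrite actd_id ?dinv_id d1comp.
- by split=> *; rewrite actd_id ?dinv_id d1comp.
Qed.

Definition flatten (A B X : D) (t u : word A B) (c : cell t u) (p : Pro B X) :
    InvDisk (act t p) (act u p) :=
  flat (w := Wone A) c (did (act u p)).

Lemma flattenE (A B X : D) (t u : word A B) (c : cell t u) (p : Pro B X) :
  flatten c p = actc c p.
Proof. by rewrite /flatten (proj1 (flatE c)) dcomp1. Qed.

Lemma flatten_eq (A B X : D) (t u : word A B) (c d : cell t u) (p : Pro B X) :
  evc c = evc d -> flatten c p = flatten d p.
Proof.
move=> H; apply: (@dcomp_injl _ _ _ _ _ _ (can t p)).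
by rewrite !flattenE -!actc_natural H.
Qed.

(** Faithfulness of the representation: acting on the unit suffices, because [can] cancels and
    whiskering with a unit is injective. *)
Lemma evc_eq (A B : D) (t u : word A B) (c d : cell t u) :
  flatten c (upro B) = flatten d (upro B) -> evc c = evc d.
Proof.
rewrite !flattenE => H; apply: whisker_upro_inj.
by apply: (dcomp_injr (d := can u (upro B))); rewrite !actc_natural H.
Qed.

End Coherence.

(** * Reification of equations between disks *)

Ltac word_of m :=
  lazymatch m with
  | odot ?a ?b => let t := word_of a in let u := word_of b in constr:(Wodot t u)
  | upro ?A => constr:(Wone A)
  | _ => constr:(Wvar m)
  end.

Ltac cell_of c :=
  lazymatch c with
  | did ?m => let t := word_of m in constr:(Cid t)
  | dcomp ?a ?b => let x := cell_of a in let y := cell_of b in constr:(Ccomp x y)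
  | dinv ?a => let x := cell_of a in constr:(Cinv x)
  | dodot ?a ?b => let x := cell_of a in let y := cell_of b in constr:(Codot x y)
  | assoc ?m ?n ?p =>
    let t := word_of m in let u := word_of n in let v := word_of p in
    constr:(Cassoc t u v)
  | lun ?m => let t := word_of m in constr:(Clun t)
  | run ?m => let t := word_of m in constr:(Crun t)
  | _ =>
    lazymatch type of c with
    | InvDisk ?m ?n =>
      let t := word_of m in let u := word_of n in constr:(@Cgen _ _ _ t u c)
    end
  end.

(** The [change] succeeds because [evc] computes the reified cells back to the original disks. *)
Ltac strictify :=
  lazymatch goal with
  | |- ?c = ?d =>
    let x := cell_of c in let y := cell_of d in
    change (evc x = evc y); apply: evc_eq
  end.

Ltac strictify_at H p :=
  lazymatch type of H with
  | ?c = ?d =>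
    let x := cell_of c in let y := cell_of d in
    change (evc x = evc y) in H;
    apply (flatten_eq p) in H; cbn [flatten flat flatV act actd] in H
  end.

(** Reification matches syntactically, so the composites and units inside components must be
    exposed; [exch] stays folded and becomes a generator. *)
Ltac unfold_components :=
  cbn [dob dpro nob npro nob2 npro2 diob dipro
       nat_id_data nat_comp_data nat_dinat_data dinat_nat_data diag_data].

(** * Sliding exchange disks through a natural transformation *)

Section Laws.

Variables C D : DblCat.

(** With [whisker_square_inv], this shows that the pairs of disks compatible with a transformation
    are closed under composition and inversion. *)
Lemma whisker_square_comp (X Y Z W : D) (x : Pro Y W) (y : Pro X Z)
    (m m' m'' : Pro X Y) (n n' n'' : Pro Z W)
    (a : InvDisk m m') (a' : InvDisk m' m'') (b : InvDisk n n') (b' : InvDisk n' n'')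
    (f : InvDisk (m ⊙ x) (y ⊙ n)) (f' : InvDisk (m' ⊙ x) (y ⊙ n'))
    (f'' : InvDisk (m'' ⊙ x) (y ⊙ n'')) :
  (a ▷ x) ;; f' = f ;; (y ◁ b) -> (a' ▷ x) ;; f'' = f' ;; (y ◁ b') ->
  ((a ;; a') ▷ x) ;; f'' = f ;; (y ◁ (b ;; b')).
Proof.
by move=> H H'; rewrite comp_whisker whisker_comp dcompA H' -!dcompA H.
Qed.

Lemma whisker_square_inv (X Y Z W : D) (x : Pro Y W) (y : Pro X Z)
    (m m' : Pro X Y) (n n' : Pro Z W) (a : InvDisk m m') (b : InvDisk n n')
    (f : InvDisk (m ⊙ x) (y ⊙ n)) (f' : InvDisk (m' ⊙ x) (y ⊙ n')) :
  (a ▷ x) ;; f' = f ;; (y ◁ b) -> (dinv a ▷ x) ;; f = f' ;; (y ◁ dinv b).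
Proof.
move=> H; apply: (dcomp_injl (c := a ▷ x)).
rewrite -!dcompA -comp_whisker dcompV dodot_id d1comp H.
by rewrite dcompA -whisker_comp dcompV dodot_id dcomp1.
Qed.

Section NatTransformations.
Variables (E : DblCat) (F G : DblFun E D) (α : NatTrans F G).

(** Naturality at a square with identity top and bottom, where [narr_id] trivializes the arrow
    components. *)
Lemma npro_fdisk (A B : E) (m n : Pro A B) (c : InvDisk m n) :
  (fdisk F c ▷ nob α B) ;; npro α n = npro α m ;; (nob α A ◁ fdisk G c).
Proof.
have N := nat_laws α.
apply: dcomp_eq; apply: sqeq_trans (sqeq_trans _ (npro_nat N (fwd c))) _.
  apply: hcomp_sqeq (sqeq_refl _); apply: vcomp_sqeq; first exact: castsqE.
  exact: (sqeq_sym (narr_id N B)).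
apply: hcomp_sqeq (sqeq_refl _) _; apply: vcomp_sqeq; first exact: (narr_id N A).
exact: (sqeq_sym (castsqE _ _ _ _ _)).
Qed.

Definition npro_pair (A B B' : E) (m : Pro A B) (n : Pro B B') :
    InvDisk ((fpro F m ⊙ fpro F n) ⊙ nob α B') (nob α A ⊙ (fpro G m ⊙ fpro G n)) :=
  assoc (fpro F m) (fpro F n) (nob α B')
  ;; (fpro F m ◁ npro α n)
  ;; dinv (assoc (fpro F m) (nob α B) (fpro G n))
  ;; (npro α m ▷ fpro G n)
  ;; assoc (nob α A) (fpro G m) (fpro G n).

Lemma npro_fcomp (A B B' : E) (m : Pro A B) (n : Pro B B') :
  (fcomp F m n ▷ nob α B') ;; npro_pair m n = npro α (m ⊙ n) ;; (nob α A ◁ fcomp G m n).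
Proof.
have := npro_odot (nat_laws α) m n.
rewrite -/(npro_pair m n) /fcomp.
move: (npro α (m ⊙ n)) (npro_pair m n) => p q.
(* [fcomp] is a cast along these equations. Once they are generalized and eliminated, both disks
   have the same boundary and [≡] becomes equality. *)
move: (fpro_odot F m n) (fpro_odot G m n) p q => e e'.
case: _ / e; case: _ / e' => p q /= /invdisk_eq ->.
by rewrite !dodot_id d1comp dcomp1.
Qed.

End NatTransformations.

Section NatExch.
Variables (F G : Difun C D) (α : NatTrans F G).

(** The four factors of [exch] are peeled off from the last: the composition comparisons pass
    through α by its compatibility with ⊙, and the images of unitors by naturality. *)
Lemma npro_exch (A A' B B' : C) (m : Pro A A') (n : Pro B B') :
  (exch F m n ▷ nob2 α A B')
  ;; (assoc (dipro F m (upro B)) (dipro F (upro A) n) (nob2 α A B')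
      ;; (dipro F m (upro B) ◁ npro2 α (upro A) n)
      ;; dinv (assoc (dipro F m (upro B)) (nob2 α A B) (dipro G (upro A) n))
      ;; (npro2 α m (upro B) ▷ dipro G (upro A) n)
      ;; assoc (nob2 α A' B) (dipro G m (upro B)) (dipro G (upro A) n)) =
  assoc (dipro F (upro A') n) (dipro F m (upro B')) (nob2 α A B')
  ;; (dipro F (upro A') n ◁ npro2 α m (upro B'))
  ;; dinv (assoc (dipro F (upro A') n) (nob2 α A' B') (dipro G m (upro B')))
  ;; (npro2 α (upro A') n ▷ dipro G m (upro B'))
  ;; assoc (nob2 α A' B) (dipro G (upro A') n) (dipro G m (upro B'))
  ;; (nob2 α A' B ◁ exch G m n).
Proof.
apply: whisker_square_comp (npro_fcomp α _ _).
apply: whisker_square_comp (whisker_square_inv (npro_fdisk α _)).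
apply: whisker_square_comp (npro_fdisk α _).
exact: whisker_square_inv (npro_fcomp α _ _).
Qed.

End NatExch.

(** * The composition laws *)

Lemma nat_id_dinat (F G : Difun C D) (α : DinatData F G) :
  dinat_cong (nat_dinat_data (nat_id_data F) α) α (fun A => lun (dob α A)).
Proof.
split=> [A B f|A B m]; first exact: (lun_nat (dbl_laws D)).
by apply: fwd_sqeq; unfold_components; strictify.
Qed.

Lemma dinat_nat_id (F G : Difun C D) (α : DinatData F G) :
  dinat_cong α (dinat_nat_data α (nat_id_data G)) (fun A => dinv (run (dob α A))).
Proof.
split=> [A B f|A B m].
  exact: (bwd_nat (c := run _) (d := run _) (run_nat (dbl_laws D) (darr α f))).
by apply: fwd_sqeq; unfold_components; strictify.
Qed.

(** Both sides apply α(B,m), β(B,m), γm, β(m,A)⁻¹, α(m,A)⁻¹ in this order, so they agree once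
    strictified. *)
Lemma nat_nat_dinat (F G H K : Difun C D) (α : NatData F G) (β : NatData G H)
    (γ : DinatData H K) :
  dinat_cong (nat_dinat_data (nat_comp_data α β) γ)
    (nat_dinat_data α (nat_dinat_data β γ))
    (fun A => assoc (nob2 α A A) (nob2 β A A) (dob γ A)).
Proof.
split=> [A B f|A B m]; first exact: (assoc_nat (dbl_laws D)).
by apply: fwd_sqeq; unfold_components; strictify.
Qed.

Lemma dinat_nat_nat (F G H K : Difun C D) (γ : DinatData F G) (δ : NatData G H)
    (ε : NatData H K) :
  dinat_cong (dinat_nat_data γ (nat_comp_data δ ε))
    (dinat_nat_data (dinat_nat_data γ δ) ε)
    (fun A => dinv (assoc (dob γ A) (nob2 δ A A) (nob2 ε A A))).
Proof.
split=> [A B f|A B m].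
  exact: (bwd_nat (c := assoc _ _ _) (d := assoc _ _ _)
    (assoc_nat (dbl_laws D) (darr γ f) (narr2 δ f f) (narr2 ε f f))).
by apply: fwd_sqeq; unfold_components; strictify.
Qed.

Lemma nat_dinat_nat (F G H K : Difun C D) (α : NatData F G) (β : DinatData G H)
    (γ : NatData H K) :
  dinat_cong (dinat_nat_data (nat_dinat_data α β) γ)
    (nat_dinat_data α (dinat_nat_data β γ))
    (fun A => assoc (nob2 α A A) (dob β A) (nob2 γ A A)).
Proof.
split=> [A B f|A B m]; first exact: (assoc_nat (dbl_laws D)).
apply: fwd_sqeq; unfold_components; strictify.
cbn [flatten flat flatV act actd].
(* The right side applies α(B,m) before γ(m,B)⁻¹; interchange restores the order of the left
   side. *)
match goal with
| |- _ = @gact _ _ _ ?t ?u ?c _ _ ;; (dinv (_ ◁ _ ◁ ?d) ;; ?k) =>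
  apply: (eq_trans _ (eq_sym (gact_naturalV (t := t) (u := u) c d k)))
end.
(* The common prefix γ(m,B)⁻¹, α(B,m), βm is removed. What remains is the interchange of α(m,A)⁻¹
   with γ(A,m). *)
do 3 apply: f_equal.
match goal with
| |- @dinv _ _ _ _ _ (@gact _ _ _ ?t ?u ?c _ _) ;; ((_ ◁ _ ◁ ?d) ;; ?k) = _ =>
  exact: (gactV_natural (t := t) (u := u) c d k)
end.
Qed.

Lemma diag_id_nat (F G : Difun C D) (α : NatTrans F G) :
  dinat_cong (dinat_nat_data (diag_data (nat_id_data F)) α) (diag_data α)
    (fun A => lun (nob2 α A A)).
Proof.
split=> [A B f|A B m]; first exact: (lun_nat (dbl_laws D)).
apply: fwd_sqeq; unfold_components; strictify.
cbn [flatten flat flatV act actd].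
(* The goal now acts on the unit at its right end, so the exchange equation must act on that same
   unit. *)
have H := npro_exch α m m; strictify_at H (upro (diob G A B)).
(* The goal follows by moving α(m,B) and α(m,A) across the exchange equation as inverses. *)
by rewrite !dcomp1 in H *; exact: dcomp_flip.
Qed.

(** The formula for the diagonalization places the exchange in G, exactly where composing with the
    diagonalized identity of G places it, so strictification settles the proarrow components. *)
Lemma nat_diag_id (F G : Difun C D) (α : NatTrans F G) :
  dinat_cong (diag_data α) (nat_dinat_data α (diag_data (nat_id_data G)))
    (fun A => dinv (run (nob2 α A A))).
Proof.
split=> [A B f|A B m].
  exact: (bwd_nat (c := run _) (d := run _) (run_nat (dbl_laws D) (narr2 α f f))).
by apply: fwd_sqeq; unfold_components; strictify.
Qed.

End Laws.

Theorem proposition3p10 (C D : DblCat) :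
  (* identity natural transformations are units *)
  (forall (F G : Difun C D) (α : DinatTrans F G),
    dinat_cong (nat_dinat_data (nat_id_data F) α) α (fun A => lun (dob α A)) /\
    dinat_cong α (dinat_nat_data α (nat_id_data G)) (fun A => dinv (run (dob α A)))) /\
  (* composition with a composite natural transformation is iterated composition *)
  (forall (F G H K : Difun C D)
      (α : NatTrans F G) (β : NatTrans G H) (γ : DinatTrans H K),
    dinat_cong (nat_dinat_data (nat_comp_data α β) γ)
      (nat_dinat_data α (nat_dinat_data β γ))
      (fun A => assoc (nob2 α A A) (nob2 β A A) (dob γ A))) /\
  (forall (F G H K : Difun C D)
      (γ : DinatTrans F G) (δ : NatTrans G H) (ε : NatTrans H K),
    dinat_cong (dinat_nat_data γ (nat_comp_data δ ε))
      (dinat_nat_data (dinat_nat_data γ δ) ε)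
      (fun A => dinv (assoc (dob γ A) (nob2 δ A A) (nob2 ε A A)))) /\
  (* two-sided composition is associative *)
  (forall (F G H K : Difun C D)
      (α : NatTrans F G) (β : DinatTrans G H) (γ : NatTrans H K),
    dinat_cong (dinat_nat_data (nat_dinat_data α β) γ)
      (nat_dinat_data α (dinat_nat_data β γ))
      (fun A => assoc (nob2 α A A) (dob β A) (nob2 γ A A))) /\
  (* composition with a diagonalized identity is diagonalization *)
  (forall (F G : Difun C D) (α : NatTrans F G),
    dinat_cong (dinat_nat_data (diag_data (nat_id_data F)) α) (diag_data α)
      (fun A => lun (nob2 α A A)) /\
    dinat_cong (diag_data α) (nat_dinat_data α (diag_data (nat_id_data G)))
      (fun A => dinv (run (nob2 α A A)))).
Proof.
split=> [F G α|]; first by split; [exact: nat_id_dinat | exact: dinat_nat_id].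
split=> [F G H K α β γ|]; first exact: nat_nat_dinat.
split=> [F G H K γ δ ε|]; first exact: dinat_nat_nat.
split=> [F G H K α β γ|F G α]; first exact: nat_dinat_nat.
by split; [exact: diag_id_nat | exact: nat_diag_id].
Qed.
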